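(* Let $0<t_0<t_1<\cdots<t_{n-1}$ be real parameters and let $M_r=(B^r_{j-1}(t_{i-1}))_{1\le i,j\le n}$ be the corresponding reverse Bessel matrix, i.e. the collocation matrix of the reverse Bessel polynomials $(B^r_0,\ldots,B^r_{n-1})$ at $t_0,\ldots,t_{n-1}$. Then $M_r$ is strictly totally positive. Moreover, given the parametrization $t_i$ ($0\le i\le n-1$), the following computations can be performed with high relative accuracy: all the eigenvalues of $M_r$, all the singular values of $M_r$, the inverse of $M_r$, and the solution of the linear systems $M_rx=b$ where $b=(b_1,\ldots,b_n)^T$ has alternating signs.
   Context: **Reverse Bessel polynomials.** $B^r_n(x)=\sum_{k=0}^n \frac{(n+k)!}{2^k(n-k)!\,k!}x^{n-k}$, $n=0,1,2,\ldots$. **Strictly totally positive (STP).** A matrix is STP if all its minors are positive. **High relative accuracy (HRA).** An algorithm can be performed with HRA if all the included subtractions are of initial data, that is, if it only includes products, divisions, sums of numbers of the same sign, and subtractions of initial data. Here the initial data are the parameters $t_0,\dots,t_{n-1}$ (and the entries of $b$ for the linear systems). As usual in numerical linear algebra, a quantity is computed to HRA when its computed value has relative error of the order of the unit roundoff, independently of the conditioning of the problem. *)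

(* Defs.v *)
From HB Require Import structures.
From mathcomp Require Import all_boot all_order all_algebra.
From mathcomp Require Import reals.

Set Implicit Arguments.
Unset Strict Implicit.
Unset Printing Implicit Defensive.

Import Order.TTheory GRing.Theory Num.Theory.
Local Open Scope ring_scope.

Section Matrices.
Variable R : realType.

Definition rev_bessel (m : nat) : {poly R} :=
  \sum_(k < m.+1)
    ((m + k)`!%:R / (2 ^+ k * (m - k)`!%:R * k`!%:R)) *: 'X^(m - k).

Definition bessel_mx (n : nat) (t : 'I_n -> R) : 'M[R]_n :=
  \matrix_(i < n, j < n) (rev_bessel j).[t i].

Definition positive_increasing (n : nat) (t : 'I_n -> R) : Prop :=
  (forall i, 0 < t i) /\ (forall i j : 'I_n, (i < j)%N -> t i < t j).

Definition strictly_totally_positive (n : nat) (A : 'M[R]_n) : Prop :=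
  forall (k : nat) (f g : 'I_k -> 'I_n),
    {homo f : i j / (i < j)%N} -> {homo g : i j / (i < j)%N} ->
    0 < \det (mxsub f g A).

(* The conditions hold only if every complex eigenvalue of A is real, and then
   lam lists all the eigenvalues with algebraic multiplicity.  The order is
   fixed so that lam is unique. *)
Definition all_eigenvalues (n : nat) (A : 'M[R]_n) (lam : 'I_n -> R) : Prop :=
  char_poly A = \prod_(k < n) ('X - (lam k)%:P) /\
  (forall i j : 'I_n, (i <= j)%N -> lam j <= lam i).

Definition all_singular_values (n : nat) (A : 'M[R]_n) (s : 'I_n -> R) : Prop :=
  (forall k, 0 <= s k) /\ all_eigenvalues (A^T *m A) (fun k => s k ^+ 2).

Definition alternating_signs (n : nat) (b : 'I_n -> R) : Prop :=
  forall i j : 'I_n, j = i.+1 :> nat -> b i * b j < 0.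

End Matrices.

(* Arithmetic formulas over initial data indexed by I.  By construction a
   subtraction only applies to two initial data.  A program that shares
   intermediate results is represented by the formulas of its outputs: since
   each occurrence of a subformula is rounded independently, the values
   reachable here include those of the program with sharing. *)
Inductive expr (I : Type) : Type :=
| EData of I
| EConst of int
| ESub of I & I
| EAdd of expr I & expr I
| EMul of expr I & expr I
| EDiv of expr I & expr I
| ESqrt of expr I.

Fixpoint sqrt_free (I : Type) (e : expr I) : bool :=
  match e with
  | EData _ | EConst _ | ESub _ _ => true
  | EAdd a b | EMul a b | EDiv a b => sqrt_free a && sqrt_free b
  | ESqrt _ => false
  end.

Section HighRelativeAccuracy.
Variables (R : realType) (I O : Type).
Implicit Types (x : I -> R) (e : expr I) (u : R).

Fixpoint eval x e : R :=
  match e with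
  | EData i => x i
  | EConst c => c%:~R
  | ESub i j => x i - x j
  | EAdd a b => eval x a + eval x b
  | EMul a b => eval x a * eval x b
  | EDiv a b => eval x a / eval x b
  | ESqrt a => Num.sqrt (eval x a)
  end.

(* Sums are of numbers of the same sign (zero is compatible with both signs),
   and divisions and square roots are defined.  Rounding with u < 1 preserves
   signs, so testing the exact values also covers the computed ones. *)
Fixpoint admissible x e : Prop :=
  match e with
  | EData _ | EConst _ | ESub _ _ => True
  | EAdd a b =>
      [/\ admissible x a, admissible x b & 0 <= eval x a * eval x b]
  | EMul a b => admissible x a /\ admissible x b
  | EDiv a b => [/\ admissible x a, admissible x b & eval x b != 0]
  | ESqrt a => admissible x a /\ 0 <= eval x a
  end.

Definition rounding u (z v : R) : Prop :=
  exists2 d : R, `|d| <= u & v = z * (1 + d).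

(* The standard model of floating-point arithmetic with unit roundoff u (no
   overflow or underflow): computed u x e v says that v is a possible computed
   value of e.  Initial data are exact; constants are rounded. *)
Fixpoint computed u x e (v : R) : Prop :=
  match e with
  | EData i => v = x i
  | EConst c => rounding u c%:~R v
  | ESub i j => rounding u (x i - x j) v
  | EAdd a b => exists va vb,
      [/\ computed u x a va, computed u x b vb & rounding u (va + vb) v]
  | EMul a b => exists va vb,
      [/\ computed u x a va, computed u x b vb & rounding u (va * vb) v]
  | EDiv a b => exists va vb,
      [/\ computed u x a va, computed u x b vb & rounding u (va / vb) v]
  | ESqrt a => exists2 va, computed u x a va & rounding u (Num.sqrt va) v
  end.

(* D is the set of allowed initial data and target x y specifies that y is the
   family of quantities to be computed from x.  The constants C and u0 do not
   depend on x, so the relative error is O(u) whatever the conditioning. *)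
Definition hra_algorithm (D : (I -> R) -> Prop)
    (target : (I -> R) -> (O -> R) -> Prop) (alg : R -> O -> expr I) : Prop :=
  exists C u0 : R, 0 < u0 /\
    forall x, D x -> exists2 y, target x y &
      forall u, 0 < u <= u0 -> forall o,
        admissible x (alg u o) /\
        (forall v, computed u x (alg u o) v -> `|v - y o| <= C * u * `|y o|).

(* One formula per quantity, for all data and all roundoffs, built from
   products, divisions, sums of numbers of the same sign and subtractions of
   initial data.  It is exact in exact arithmetic: its exact value is among the
   computed ones for every u, hence equals the target as u tends to 0. *)
Definition hra_direct (D : (I -> R) -> Prop)
    (target : (I -> R) -> (O -> R) -> Prop) : Prop :=
  exists2 e : O -> expr I,
    (forall o, sqrt_free (e o)) & hra_algorithm D target (fun _ => e).

(* For quantities that are not rational functions of the data: the number of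
   iterations, hence the formula, may depend on the roundoff u (but not on the
   data), and square roots of nonnegative numbers, rounded like the other
   operations, are allowed. *)
Definition hra_iterative (D : (I -> R) -> Prop)
    (target : (I -> R) -> (O -> R) -> Prop) : Prop :=
  exists alg : R -> O -> expr I, hra_algorithm D target alg.

End HighRelativeAccuracy.

Section Computations.
Variables (R : realType) (n : nat).

Definition eigenvalue_target (t lam : 'I_n -> R) : Prop :=
  all_eigenvalues (bessel_mx t) lam.

Definition singular_value_target (t s : 'I_n -> R) : Prop :=
  all_singular_values (bessel_mx t) s.

Definition inverse_target (t : 'I_n -> R) (Y : 'I_n * 'I_n -> R) : Prop :=
  bessel_mx t \in unitmx /\
  forall i j, Y (i, j) = invmx (bessel_mx t) i j.

(* Here the initial data are the nodes t (left) and the right-hand side b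
   (right). *)
Definition system_data (x : 'I_n + 'I_n -> R) : Prop :=
  positive_increasing (fun i => x (inl i)) /\
  alternating_signs (fun i => x (inr i)).

Definition system_target (x : 'I_n + 'I_n -> R) (y : 'I_n -> R) : Prop :=
  bessel_mx (fun i => x (inl i)) *m (\col_i y i) = \col_i x (inr i).

End Computations.

(* Main.v *)
Require Import Defs.
From mathcomp Require Import all_boot all_order all_algebra.
From mathcomp Require Import fingroup perm.
From mathcomp Require Import reals.
From mathcomp Require Import ring lra zify.
From mathcomp Require Import complex spectral.
From mathcomp Require boolp.

(** Everything rests on the minors of the reverse Bessel matrix [M]: each of
    them is positive and has a fixed subtraction-free formula in the nodes.

    Write [M = V C], where [V] holds the powers of the nodes and [C] the
    coefficients of the polynomials, and expand a minor of [M] by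
    [Cauchy_Binet].  A minor of [V] is a generalized Vandermonde determinant;
    eliminating its first row writes it as a product of differences of nodes
    times a sum, with monomial weights, of smaller determinants of the same
    kind ([alternant_recursion]), so that by induction it is positive and only
    subtracts nodes.  The minors of [C] are rational constants.  Up to positive
    row and column factors, [C] is the array of binomial coefficients
    [path_count], which counts lattice paths and is built from the empty array by
    prepending a unit row and column and by adding a row to the previous one;
    both preserve nonnegative minors ([tn_path_count]).  Hence the minors of [M]
    are positive ([bessel_minors]), which gives strict total positivity.  The
    entries of the inverse are signed quotients of minors
    ([signed_inverse]), and when the right-hand side alternates in
    sign all the terms of [M^-1 b] have the same sign.

    For the eigenvalues, let [C_k] be the [k]-th compound of a strictly totally
    positive matrix.  It has positive entries, and the trace of [C_k ^ N] is the
    [k]-th elementary symmetric function of the [N]-th powers of the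
    eigenvalues.  Perron's theorem, proved here from traces alone
    ([perron_trace]), shows that the product of the [k] eigenvalues largest in
    modulus is positive for each [k]; so all the eigenvalues are positive
    ([stp_eigenvalues]).  Moreover, with [m] the size of [C_k],
    the [N]-th root of the trace of [C_k ^ N] lies within a factor
    [m ^ (1 / N)] of the product of the [k] largest eigenvalues,
    whatever the matrix.  Taking [N = 2 ^ s] with [N] at least [m / u], this
    factor is no worse than one rounding error.  The power is obtained by [s]
    squarings, which multiply the relative error by about [N], and the root by
    [s] square roots, which divide it by [N]: the total remains [O(u)]
    ([iterative_leading_product]).  Quotients of consecutive products are the
    eigenvalues.  The singular values are the square roots of the eigenvalues of
    [M^T M], whose minors are sums of products of minors of [M]. *)

Set Implicit Arguments.
Unset Strict Implicit.
Unset Printing Implicit Defensive.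
Import Order.TTheory GRing.Theory Num.Theory.
Local Open Scope ring_scope.

(** * Cauchy-Binet and compound matrices *)

Definition incr (k n : nat) (f : 'I_k -> 'I_n) : bool :=
  [forall i : 'I_k, forall j : 'I_k, (i < j)%N ==> (f i < f j)%N].

Lemma incrP (k n : nat) (f : 'I_k -> 'I_n) :
  reflect {homo f : i j / (i < j)%N} (incr f).
Proof.
apply: (iffP 'forall_'forall_implyP) => H i j; exact: H.
Qed.

Lemma incr_inj (k n : nat) (f : 'I_k -> 'I_n) : incr f -> injective f.
Proof.
move=> /incrP hf i j eqf; apply/val_inj; apply/eqP.
by case: ltngtP => // /hf; rewrite eqf ltnn.
Qed.

Lemma incr_ge (k n : nat) (f : 'I_k -> 'I_n) : incr f -> forall i : 'I_k, (i <= f i)%N.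
Proof.
move=> /incrP hf [l]; elim: l => [|l IH] // ltl.
apply: leq_ltn_trans (IH (ltnW ltl)) _; exact: hf.
Qed.

(** A strictly increasing map of an initial segment lies above the identity, and
    so does its inverse. *)
Lemma incr_perm1 (k : nat) (s : 'S_k) : incr s -> s = 1%g.
Proof.
move=> hs.
have hsV : incr (s^-1)%g.
  apply/incrP => i j ltij; rewrite ltnNge; apply/negP; rewrite leq_eqVlt.
  case/orP => [/eqP/val_inj/perm_inj eqji | /(incrP _ hs)].
    by rewrite eqji ltnn in ltij.
  by rewrite !permKV ltnNge ltnW.
apply/permP => i; rewrite perm1; apply/val_inj/eqP.
rewrite eqn_leq (incr_ge hs) andbT.
by have := incr_ge hsV (s i); rewrite permK.
Qed.

Definition incrs (k n : nat) := [set h : {ffun 'I_k -> 'I_n} | incr h].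

(** Sorting the values of an injection. *)
Lemma injective_incr_perm (k n : nat) (f : {ffun 'I_k -> 'I_n}) :
  injective f -> exists2 h, h \in incrs k n & exists s : 'S_k, f = [ffun i => h (s i)].
Proof.
move=> injf; pose leI (i j : 'I_n) := (i <= j)%N.
have totI : total leI by move=> i j; exact: leq_total.
have trI : transitive leI by move=> i j l; exact: leq_trans.
pose t := [tuple f i | i < k].
have /tuple_permP [p Ep] : perm_eq (sort leI t) t by rewrite perm_sort.
have sorted_p : sorted leI (sort leI t) by exact: sort_sorted.
exists [ffun i => f (p i)].
  rewrite inE; apply/incrP => i j ltij; rewrite !ffunE ltn_neqAle.
  apply/andP; split.
    apply/eqP => /val_inj/injf/perm_inj eqij; by rewrite eqij ltnn in ltij.
  have nthp (l : 'I_k) : nth (f i) (sort leI t) l = f (p l).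
    by rewrite Ep -tnth_nth !tnth_mktuple.
  have := sorted_leq_nth trI (fun i : 'I_n => leqnn i) (f i) sorted_p.
  move=> /(_ i j); rewrite !inE size_sort size_tuple !nthp; apply => //; exact: ltnW.
by exists (p^-1)%g; apply/ffunP => i; rewrite !ffunE permKV.
Qed.

Lemma incr_perm_unique (k n : nat) (h1 h2 : {ffun 'I_k -> 'I_n}) (s1 s2 : 'S_k) :
  incr h1 -> incr h2 -> (forall i, h1 (s1 i) = h2 (s2 i)) -> h1 = h2 /\ s1 = s2.
Proof.
move=> i1 i2 E.
have E1 i : h1 i = h2 ((s1^-1 * s2)%g i) by rewrite permM -E permKV.
have /incr_perm1 s1s2 : incr (s1^-1 * s2)%g.
  apply/incrP => i j ltij; rewrite ltnNge; apply/negP; rewrite leq_eqVlt.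
  case/orP => [/eqP/val_inj/perm_inj eqji | /(incrP _ i2)].
    by rewrite eqji ltnn in ltij.
  by rewrite -!E1 ltnNge ltnW //; apply: (incrP _ i1).
split; first by apply/ffunP => i; rewrite E1 s1s2 perm1.
by rewrite -[s2]mul1g -(mulgV s1) -mulgA s1s2 mulg1.
Qed.

(** Multilinearity in the rows of the product, each of which is a combination of
    the rows of [B]. *)
Lemma det_mulmx_expand (R : comNzRingType) (k n : nat)
    (A : 'M[R]_(k, n)) (B : 'M[R]_(n, k)) :
  \det (A *m B) =
  \sum_(f : {ffun 'I_k -> 'I_n}) (\prod_i A i (f i)) * \det (rowsub f B).
Proof.
pose AB (s : 'S_k) i j := A i j * B j (s i).
transitivity (\sum_(f : {ffun 'I_k -> 'I_n}) \sum_(s : 'S_k)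
    (-1) ^+ s * \prod_i AB s i (f i)).
  rewrite exchange_big; apply: eq_bigr => /= s _; rewrite -big_distrr /=.
  congr (_ * _); rewrite -(bigA_distr_bigA (AB s)) /=.
  by apply: eq_bigr => x _; rewrite mxE.
apply: eq_bigr => f _; rewrite mulr_sumr; apply: eq_bigr => s _.
rewrite mulrCA big_split //=; congr (_ * (_ * _)).
by apply: eq_bigr => x _; rewrite mxE.
Qed.

(** In [det_mulmx_expand], a map that is not injective repeats a row of [B] and
    contributes nothing; the injections with the same image differ by a
    permutation of the indices, and their terms add up to a minor of [A]. *)
Theorem Cauchy_Binet (R : comNzRingType) (k n : nat)
    (A : 'M[R]_(k, n)) (B : 'M[R]_(n, k)) :
  \det (A *m B) =
  \sum_(h in incrs k n) \det (colsub h A) * \det (rowsub h B).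
Proof.
rewrite det_mulmx_expand.
pose F (f : {ffun 'I_k -> 'I_n}) := (\prod_i A i (f i)) * \det (rowsub f B).
rewrite -[LHS]/(\sum_f F f).
rewrite (bigID (fun f : {ffun 'I_k -> 'I_n} => injectiveb f)) /=.
rewrite addrC big1 ?add0r; last first.
  move=> f /injectivePn[i1 [i2 Di12 Ef12]].
  rewrite /F (determinant_alternate Di12) ?mulr0 // => j; by rewrite !mxE Ef12.
pose c (p : {ffun 'I_k -> 'I_n} * 'S_k) := [ffun i => p.1 (p.2 i)].
have injc : {in setX (incrs k n) [set: 'S_k] &, injective c}.
  move=> [h1 s1] [h2 s2] /setXP[] /=; rewrite !inE => i1 _ /andP[i2 _].
  move=> /ffunP E; have [|-> ->] // := @incr_perm_unique _ _ h1 h2 s1 s2 i1 i2.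
  by move=> i; have := E i; rewrite !ffunE.
transitivity (\sum_(f in c @: setX (incrs k n) [set: 'S_k]) F f).
  apply: eq_bigl => f; apply/injectiveP/imsetP => [/injective_incr_perm[h Hh [s Es]]|].
    by exists (h, s); rewrite // inE Hh inE.
  move=> [[h s]] /setXP[/=]; rewrite inE => /incr_inj injh _ -> i j.
  by rewrite !ffunE => /injh/perm_inj.
rewrite big_imset //=.
rewrite (eq_bigl (fun p => (p.1 \in incrs k n) && true)); last first.
  by move=> p; rewrite inE in_setT.
rewrite -(pair_big (fun h => h \in incrs k n) xpredT (fun h s => F (c (h, s)))) /=.
apply: eq_bigr => h _; rewrite {2}/determinant mulr_suml.
apply: eq_bigr => s _; rewrite /F.
have -> : rowsub (c (h, s)) B = row_perm s (rowsub h B).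
  by apply/matrixP => i j; rewrite !mxE ffunE.
rewrite row_permE det_mulmx det_perm mulrA [_ * (-1) ^+ s]mulrC.
congr (_ * _ * _); apply: eq_bigr => i _; by rewrite mxE ffunE.
Qed.

Lemma det_mxsub_mulmx (R : comNzRingType) (m n p k : nat) (A : 'M[R]_(m, n))
    (B : 'M[R]_(n, p)) (f : 'I_k -> 'I_m) (g : 'I_k -> 'I_p) :
  \det (mxsub f g (A *m B)) =
  \sum_(h in incrs k n) \det (mxsub f h A) * \det (mxsub h g B).
Proof.
rewrite mxsub_mul Cauchy_Binet; apply: eq_bigr => h _.
by congr (_ * _); congr (\det _); apply/matrixP => i j; rewrite !mxE.
Qed.

Section Compound.
Variables (R : comNzRingType) (k n : nat).

Definition incr_val (i : 'I_#|incrs k n|) : {ffun 'I_k -> 'I_n} := enum_val i.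

Lemma incr_valP i : incr (incr_val i).
Proof. by have := enum_valP i; rewrite inE. Qed.

Definition compound (A : 'M[R]_n) : 'M[R]_#|incrs k n| :=
  \matrix_(i, j) \det (mxsub (incr_val i) (incr_val j) A).

Lemma compoundM (A B : 'M[R]_n) : compound (A *m B) = compound A *m compound B.
Proof.
apply/matrixP => i j; rewrite !mxE det_mxsub_mulmx big_enum_val /=.
by apply: eq_bigr => l _; rewrite !mxE.
Qed.

(** Increasing selections keep a triangular matrix triangular. *)
Lemma det_mxsub_trig (A : 'M[R]_n) (h : 'I_k -> 'I_n) :
  is_trig_mx A -> incr h -> \det (mxsub h h A) = \prod_j A (h j) (h j).
Proof.
move=> /is_trig_mxP tA /incrP hh; rewrite det_trig.
  by apply: eq_bigr => i _; rewrite mxE.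
by apply/is_trig_mxP => i j ltij; rewrite mxE tA // hh.
Qed.

Lemma compound1 : compound 1%:M = 1%:M.
Proof.
apply/matrixP => i j; rewrite !mxE.
have [<-|neij] := eqVneq i j.
  rewrite det_mxsub_trig; first by rewrite big1 // => l _; rewrite mxE eqxx.
    exact: scalar_mx_is_trig.
  exact: incr_valP.
set h := incr_val i; set g := incr_val j.
have Hh : incr h := incr_valP i.
have Hg : incr g := incr_valP j.
(* A nonzero minor of the identity has a nonzero term in its expansion, so that
   its rows and columns are the same up to a permutation. *)
apply/eqP; rewrite -[_ == _]negbK; apply/negP => d0.
have [s Hs] : exists s : 'S_k, forall l, h l = g (s l).
  have [s] : exists s : 'S_k, \prod_l (mxsub h g (1%:M : 'M[R]_n)) l (s l) != 0.
    apply/existsP; rewrite -negb_forall; apply: contra d0.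
    move=> /forallP all0; apply/eqP; rewrite /determinant big1 // => s _.
    by have /eqP := all0 s; rewrite /= => ->; rewrite mulr0.
  move=> ne0; exists s => l; apply/eqP; apply: contraNT ne0 => hl.
  by rewrite (bigD1 l) //= !mxE (negPf hl) mul0r.
have [|E _] := @incr_perm_unique _ _ h g 1%g s Hh Hg.
  by move=> l; rewrite perm1.
by move/enum_val_inj: E => /eqP; apply/negP.
Qed.

End Compound.

(** * Perron and Gantmacher-Krein theorems by traces *)

Lemma bernoulli (R : realDomainType) (h : R) (N : nat) :
  0 <= h -> 1 + N%:R * h <= (1 + h) ^+ N.
Proof.
move=> h0; elim: N => [|N IH]; first by rewrite mul0r addr0.
rewrite exprS; have N0 : 0 <= N%:R :> R by [].
apply: le_trans (ler_wpM2l _ IH); last by rewrite addr_ge0.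
by rewrite -natr1; nra.
Qed.

Lemma growth_le (R : realType) (A K a b : R) :
  0 < A -> 0 <= a -> 0 <= b ->
  (forall N, A * a ^+ N <= K * b ^+ N) -> a <= b.
Proof.
move=> A0 a0 b0 H; rewrite leNgt; apply/negP => ltba.
have [b_eq0|b_gt0] := eqVneq b 0.
  have := H 1%N; rewrite b_eq0 !expr1 mulr0 leNgt pmulr_rgt0 //.
  by rewrite -{1}b_eq0 ltba.
have {b_gt0}b0' : 0 < b by rewrite lt_def b_gt0.
pose h := a / b - 1.
have h0 : 0 < h by rewrite subr_gt0 ltr_pdivlMr // mul1r.
have Hk N : A * (1 + N%:R * h) <= K.
  apply: le_trans (ler_wpM2l (ltW A0) (bernoulli N (ltW h0))) _.
  by rewrite /h addrC subrK expr_div_n mulrA ler_pdivrMr ?exprn_gt0 //; exact: H.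
have K0 : 0 < K by apply: lt_le_trans (Hk 0%N); rewrite mul0r addr0 mulr1.
have Ah0 : 0 < A * h by rewrite mulr_gt0.
have := Hk (Num.bound (K / (A * h))).
have := archi_boundP (ltW (divr_gt0 K0 Ah0)).
set N := Num.bound _; rewrite ltr_pdivrMr // => ltK.
by move: ltK A0; nra.
Qed.

Local Open Scope complex_scope.

Lemma growth_leC (R : realType) (A K a b : R[i]) :
  0 < A -> 0 <= K -> 0 <= a -> 0 <= b ->
  (forall N, A * a ^+ N <= K * b ^+ N) -> a <= b.
Proof.
have toR (z : R[i]) : 0 <= z -> exists2 x : R, 0 <= x & z = x%:C.
  case: z => x y; rewrite lecE /= => /andP[/eqP -> x0].
  by exists x.
move=> A0 /toR[K' _ ->] /toR[a' a0 ->] /toR[b' b0 ->].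
have [A' A'0 EA] := toR _ (ltW A0); move: A0; rewrite {}EA ltcR => A0 H.
rewrite lecR; apply: (growth_le (K := K') A0) => // N.
by have := H N; rewrite -!rmorphXn -!rmorphM lecR.
Qed.

(** Weighting the power sums with the coefficients of the polynomial that
    vanishes at all the other values isolates the powers of a single value. *)
Lemma power_sum_bound (R : realType) (S : finType) (y : S -> R[i]) (K r : R[i]) :
  0 <= K -> 0 <= r ->
  (forall N, `|\sum_s y s ^+ N| <= K * r ^+ N) -> forall s, `|y s| <= r.
Proof.
move=> K0 r0 H s1.
pose p : {poly R[i]} := \prod_(s | y s != y s1) ('X - (y s)%:P).
have p0 s : y s != y s1 -> p.[y s] = 0.
  move=> ne; rewrite /p horner_prod (bigD1 s) //= !hornerE subrr mul0r //.
have p1 : p.[y s1] != 0.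
  rewrite /p horner_prod; apply/prodf_neq0 => s ne.
  by rewrite !hornerE subr_eq0 eq_sym.
pose A := `|p.[y s1]| *+ #|[pred s | y s == y s1]|.
have A0 : 0 < A.
  rewrite pmulrn_lgt0 ?normr_gt0 //; apply/card_gt0P; exists s1; exact: eqxx.
apply: (growth_leC (K := \sum_(l < size p) `|p`_l| * K * r ^+ l) A0) => //.
  by apply: sumr_ge0 => l _; rewrite !mulr_ge0 // exprn_ge0.
move=> N.
have -> : A * `|y s1| ^+ N = `|\sum_s y s ^+ N * p.[y s]|.
  rewrite (bigID (fun s => y s == y s1)) /= [X in _ + X]big1 => [|s ne]; last first.
    by rewrite p0 ?mulr0.
  rewrite (eq_bigr (fun=> y s1 ^+ N * p.[y s1])); last by move=> s /eqP ->.
  by rewrite sumr_const addr0 normrMn normrM normrX /A mulrnAl mulrC.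
have -> : \sum_s y s ^+ N * p.[y s] =
    \sum_(l < size p) p`_l * \sum_s y s ^+ (N + l).
  rewrite (eq_bigr (fun s => \sum_(l < size p) p`_l * y s ^+ (N + l))).
    by rewrite exchange_big /=; apply: eq_bigr => l _; rewrite mulr_sumr.
  move=> s _; rewrite horner_coef mulr_sumr; apply: eq_bigr => l _.
  by rewrite exprD mulrCA.
apply: le_trans (ler_norm_sum _ _ _) _; rewrite mulr_suml; apply: ler_sum => l _.
rewrite normrM -!mulrA ler_wpM2l // -exprD addnC; exact: H.
Qed.

Lemma expmx_ge0 (R : realDomainType) (m : nat) (P : 'M[R]_m) :
  (forall i j, 0 <= P i j) -> forall N i j, 0 <= (P ^+ N) i j.
Proof.
move=> P0; elim=> [|N IH] i j; first by rewrite expr0 mxE ler0n.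
by rewrite exprS mxE; apply: sumr_ge0 => l _; rewrite mulr_ge0.
Qed.

Lemma trace_shift (R : comNzRingType) (m N : nat) (A : 'M[R]_m) (a : R) :
  \tr ((A + a%:M) ^+ N) =
  \sum_(j < N.+1) (a ^+ j * \tr (A ^+ (N - j))) *+ 'C(N, j).
Proof.
have cAa : GRing.comm A (a%:M) by rewrite /GRing.comm -!mulmxE scalar_mxC.
have scX j : (a%:M : 'M[R]_m) ^+ j = (a ^+ j)%:M.
  elim: j => [|j IH]; first by rewrite !expr0.
  by rewrite !exprS IH -mulmxE -scalar_mxM.
rewrite (exprDn_comm _ cAa) raddf_sum; apply: eq_bigr => j _.
rewrite raddfMn /= scX -mulmxE scalar_mxC mul_scalar_mx mxtraceZ //.
Qed.

(** Let [r] be the largest modulus.  With [c] the least diagonal entry,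
    [Q = P - c] is nonnegative, and the traces of [P ^ N], which are at most a
    multiple of [r ^ N], expand binomially into nonnegative traces of powers of
    [Q].  Dividing all the [z s - c] by a common phase [phi] only multiplies the
    terms of this expansion by numbers of modulus one, so the power sums of the
    [c + (z s - c) / phi] obey the same bound, and [power_sum_bound] gives
    [`|c + (z s - c) / phi| <= r].  With [phi] the phase of [z s0 - c] and
    [s = s0] this reads [c + `|z s0 - c| <= `|z s0|], the equality case of the
    triangle inequality. *)
Lemma perron_trace (R : realType) (m : nat) (P : 'M[R]_m) (S : finType)
    (z : S -> R[i]) (s0 : S) :
  (0 < m)%N -> (forall i j, 0 < P i j) ->
  (forall N, (\tr (P ^+ N))%:C = \sum_s z s ^+ N) ->
  (forall s, `|z s| <= `|z s0|) -> 0 < z s0.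
Proof.
move=> m0 P0 trP zmax.
have [c c0 cP] : exists2 c : R, 0 < c & forall i, c <= P i i.
  pose i0 := Ordinal m0.
  exists (P [arg min_(i < i0) P i i]%O [arg min_(i < i0) P i i]%O) => //.
  by case: arg_minP => // i _ H j; exact: H.
pose Q := P + (- c)%:M.
have Q0 i j : 0 <= Q i j.
  rewrite !mxE; have [->|ne] := eqVneq i j; last by rewrite mulr0n addr0 ltW.
  by rewrite mulr1n subr_ge0.
have trQ0 N : 0 <= \tr (Q ^+ N).
  by apply: sumr_ge0 => i _; exact: expmx_ge0.
have trQ N : (\tr (Q ^+ N))%:C = \sum_s (z s - c%:C) ^+ N.
  rewrite trace_shift rmorph_sum /=.
  rewrite (eq_bigr (fun s => \sum_(j < N.+1) ((- c)%:C ^+ j * z s ^+ (N - j)) *+ 'C(N, j))).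
    rewrite exchange_big /=; apply: eq_bigr => j _.
    by rewrite sumrMnl rmorphMn rmorphM rmorphXn /= trP mulr_sumr.
  move=> s _; rewrite exprDn; apply: eq_bigr => j _.
  by rewrite -rmorphN mulrC.
have trPQ N : \tr (P ^+ N) = \sum_(j < N.+1) (c ^+ j * \tr (Q ^+ (N - j))) *+ 'C(N, j).
  by rewrite -trace_shift /Q -addrA -raddfD /= addNr raddf0 addr0.
pose w := z s0 - c%:C.
have cC0 : 0 < c%:C by rewrite ltcR.
have [w0|w_neq0] := eqVneq w 0.
  by move/eqP: w0; rewrite subr_eq0 => /eqP ->.
pose phi := w / `|w|.
have phi1 : `|phi| = 1 by rewrite normrM normfV normr_id divff // normr_eq0.
pose y s := c%:C + (z s - c%:C) / phi.
have ysum N : \sum_s y s ^+ N =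
    \sum_(j < N.+1) (c%:C ^+ j * (phi ^- (N - j) * (\tr (Q ^+ (N - j)))%:C)) *+ 'C(N, j).
  rewrite (eq_bigr (fun s => \sum_(j < N.+1)
     (c%:C ^+ j * (phi ^- (N - j) * (z s - c%:C) ^+ (N - j))) *+ 'C(N, j))).
    rewrite exchange_big /=; apply: eq_bigr => j _.
    by rewrite sumrMnl trQ -mulr_sumr -mulr_sumr.
  move=> s _; rewrite /y addrC exprDn; apply: eq_bigr => j _.
  by rewrite expr_div_n [_ / _]mulrC [_ * c%:C ^+ _]mulrC.
have ybound N : `|\sum_s y s ^+ N| <= #|S|%:R * `|z s0| ^+ N.
  apply: (le_trans (y := (\tr (P ^+ N))%:C)).
    rewrite ysum; apply: le_trans (ler_norm_sum _ _ _) _.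
    rewrite trPQ rmorph_sum /=; apply: ler_sum => j _.
    rewrite normrMn rmorphMn lerMn2r; apply/orP; right.
    rewrite !normrM normfV !normrX phi1 expr1n invr1 mul1r rmorphM rmorphXn /=.
    by rewrite !ger0_norm ?lecR // ltW.
  apply: le_trans (real_ler_norm _) _; first by apply: ger0_real; rewrite lecR trPQ;
    apply: sumr_ge0 => j _; rewrite mulrn_wge0 // mulr_ge0 // exprn_ge0 // ltW.
  rewrite trP; apply: le_trans (ler_norm_sum _ _ _) _.
  rewrite -sum1_card natr_sum mulr_suml; apply: ler_sum => s _.
  by rewrite normrX mul1r lerXn2r ?nnegrE.
have := power_sum_bound (ler0n _ _) (normr_ge0 _) ybound s0.
have -> : y s0 = c%:C + `|w|.
  by rewrite /y -/w /phi invfM invrK mulrA divff // mul1r.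
rewrite ger0_norm ?addr_ge0 ?normr_ge0 ?(ltW cC0) // => le1.
have zE : z s0 = c%:C + w by rewrite /w addrC subrK.
have : `|c%:C + w| = `|c%:C| + `|w|.
  by apply/le_anti; rewrite ler_normD -zE (gtr0_norm cC0) le1.
case/normCDeq => t t1 []; rewrite !(gtr0_norm cC0) => Ec Ew.
have t_eq1 : t = 1.
  by apply: (mulfI (x := c%:C)); rewrite ?gt_eqF // mulr1 -Ec.
by rewrite zE Ew t_eq1 mulr1 ltr_wpDr.
Qed.

Section CompoundTrace.
Variables (R : comUnitRingType) (n : nat).
Implicit Types (A U : 'M[R]_n).

Lemma compoundX k A N : compound k (A ^+ N) = compound k A ^+ N.
Proof.
elim: N => [|N IH]; first by rewrite !expr0 compound1.
by rewrite !exprS -mulmxE compoundM IH.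
Qed.

Lemma trace_compound_conj k N A U : U \in unitmx ->
  \tr (compound k (U *m A *m invmx U) ^+ N) = \tr (compound k A ^+ N).
Proof.
move=> uU; set V := compound k U; set W := compound k (invmx U).
have WV : W *m V = 1%:M by rewrite -compoundM mulVmx // compound1.
have VW : V *m W = 1%:M by rewrite -compoundM mulmxV // compound1.
have -> : compound k (U *m A *m invmx U) ^+ N = V *m compound k A ^+ N *m W.
  rewrite !compoundM -/V -/W; elim: N => [|N IH]; first by rewrite !expr0 mulmx1 VW.
  by rewrite !exprS -!mulmxE IH !mulmxA -[_ *m W *m V]mulmxA WV mulmx1.
by rewrite mxtrace_mulC mulmxA WV mul1mx.
Qed.

Lemma trig_mxX A N : is_trig_mx A ->
  is_trig_mx (A ^+ N) /\ forall i, (A ^+ N) i i = A i i ^+ N.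
Proof.
move=> /is_trig_mxP tA; elim: N => [|N [/is_trig_mxP tN dN]].
  by split=> [|i]; rewrite expr0 ?scalar_mx_is_trig // mxE eqxx.
split=> [|i].
  apply/is_trig_mxP => i j ltij; rewrite exprS mxE big1 // => l _.
  have [leil|ltil] := leqP l i; last by rewrite tA ?mul0r.
  by rewrite tN ?mulr0 //; exact: leq_ltn_trans ltij.
rewrite exprS mxE (bigD1 i) //= dN -exprS big1 ?addr0 // => l neli.
have [ltil|ltli|eqil] := ltngtP i l; first by rewrite tA ?mul0r.
  by rewrite tN ?mulr0.
by move: neli; rewrite -(val_inj eqil) eqxx.
Qed.

Lemma trace_compound_trig k N A : is_trig_mx A ->
  \tr (compound k A ^+ N) =
  \sum_(h in incrs k n) (\prod_j A (h j) (h j)) ^+ N.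
Proof.
move=> tA; have [tAN dAN] := trig_mxX N tA.
rewrite -compoundX big_enum_val; apply: eq_bigr => i _.
rewrite mxE det_mxsub_trig ?incr_valP // -prodrXl.
by apply: eq_bigr => j _; rewrite dAN.
Qed.

Lemma char_poly_conj A U : U \in unitmx ->
  char_poly (U *m A *m invmx U) = char_poly A.
Proof.
move=> uU; rewrite /char_poly /char_poly_mx !map_mxM /=.
set u := map_mx polyC U; set v := map_mx polyC (invmx U).
have uv : u *m v = 1%:M by rewrite -map_mxM mulmxV // map_mx1.
have -> : 'X%:M - u *m map_mx polyC A *m v =
    u *m ('X%:M - map_mx polyC A) *m v.
  by rewrite mulmxBr mulmxBl scalar_mxC -['X%:M *m u *m v]mulmxA uv mulmx1.
by rewrite !det_mulmx mulrAC -det_mulmx uv det1 mul1r.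
Qed.

End CompoundTrace.

Lemma map_compound (R S : comNzRingType) (f : {rmorphism R -> S}) k n (A : 'M[R]_n) :
  map_mx f (compound k A) = compound k (map_mx f A).
Proof.
apply/matrixP => i j; rewrite !mxE -det_map_mx; congr (\det _).
by apply/matrixP => a b; rewrite !mxE.
Qed.

(** Compounds are multiplicative, so their traces can be read off a triangular
    matrix similar to [A]; conjugating by a permutation matrix then sorts its
    diagonal. *)
Lemma compound_eigenvalues (C : numClosedFieldType) (n : nat) (A : 'M[C]_n) :
  exists z : 'I_n -> C,
  [/\ char_poly A = \prod_(i < n) ('X - (z i)%:P),
      forall i j : 'I_n, (i <= j)%N -> `|z j| <= `|z i| &
      forall k N, \tr (compound k A ^+ N) =
        \sum_(h in incrs k n) (\prod_j z (h j)) ^+ N].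
Proof.
have [U uU /=] : exists2 U : 'M[C]_n, U \in unitmx & is_trig_mx (U *m A *m invmx U).
  have [] := @cotrigonalization C n [:: A].
    by move=> ? ? /=; rewrite !in_cons !orbF => /eqP-> /eqP->.
  move=> U uU /=; rewrite andbT => H; exists U; first exact: unitarymx_unit.
  by rewrite -conjumx // unitarymx_unit.
move: (U *m A *m invmx U) (char_poly_conj A uU)
  (fun k N => trace_compound_conj k N A uU) => T <- trT tT; pose d i := T i i.
pose le (a b : C) := `|b| <= `|a|.
pose t := [tuple d i | i < n].
have /tuple_permP[s Es] : perm_eq (sort le t) t by rewrite perm_sort.
pose z i := d (s i).
have znth (x : C) (i : 'I_n) : nth x (sort le t) i = z i.
  by rewrite Es -tnth_nth !tnth_mktuple.
have le_tot : total le by move=> a b; apply: real_leVge; apply: normr_real.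
have le_tr : transitive le by move=> a b c /[swap]; exact: le_trans.
exists z; split.
- rewrite char_poly_trig // (reindex_inj (@perm_inj _ s)).
  exact: eq_bigr.
- move=> i j leij; have := sorted_leq_nth le_tr (fun a => lexx _) 0 (sort_sorted le_tot t).
  by move=> /(_ i j); rewrite !inE size_sort size_tuple !znth !ltn_ord; exact.
move=> k N; rewrite -trT trace_compound_trig //.
transitivity (\tr (compound k (diag_mx (\row_i d i)) ^+ N)).
  rewrite trace_compound_trig ?diag_mx_is_trig //; apply: eq_bigr => h _.
  by congr (_ ^+ _); apply: eq_bigr => j _; rewrite !mxE eqxx.
rewrite -(trace_compound_conj _ _ _ (unitmx_perm _ s)).
have -> : perm_mx s *m diag_mx (\row_i d i) *m invmx (perm_mx s) =
    diag_mx (\row_i z i).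
  apply/esym/(canRL (mulmxK (unitmx_perm _ s))).
  rewrite -[s in _ *m perm_mx s]invgK -col_permE -row_permE.
  apply/matrixP => i j; rewrite !mxE -(inj_eq (@perm_inj _ s)) permKV.
  by rewrite /z; case: eqVneq => [->|].
rewrite trace_compound_trig ?diag_mx_is_trig //; apply: eq_bigr => h _.
by congr (_ ^+ _); apply: eq_bigr => j _; rewrite !mxE eqxx.
Qed.

(** The theorem of Gantmacher and Krein: by [perron_trace] applied to the
    compounds, the product of the [k] eigenvalues largest in modulus is positive
    for each [k].  The traces are kept in the conclusion because the algorithm
    computes them. *)
Theorem stp_eigenvalues (R : realType) (n : nat) (A : 'M[R]_n) :
  strictly_totally_positive A ->
  exists lam : 'I_n -> R,
  [/\ all_eigenvalues A lam, forall i, 0 < lam i &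
      forall k N, \tr (compound k A ^+ N) =
        \sum_(h in incrs k n) (\prod_j lam (h j)) ^+ N].
Proof.
move=> stpA; pose f : {rmorphism R -> R[i]} := real_complex R.
have [z [charz zsort ztr]] := compound_eigenvalues (map_mx f A).
have zprod k (lekn : (k <= n)%N) : 0 < \prod_(i < k) z (widen_ord lekn i).
  pose w : {ffun 'I_k -> 'I_n} := [ffun i => widen_ord lekn i].
  have inw : w \in incrs k n.
    by rewrite inE; apply/incrP => i j; rewrite !ffunE.
  pose m := #|incrs k n|.
  pose zS (i : 'I_m) := \prod_j z (incr_val i j).
  have -> : \prod_(i < k) z (widen_ord lekn i) = zS (enum_rank_in inw w).
    by apply: eq_bigr => j _; rewrite /incr_val enum_rankK_in // ffunE.
  apply: (perron_trace (P := compound k A)).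
  - by apply/card_gt0P; exists w.
  - by move=> i j; rewrite mxE; apply: stpA; apply/incrP; apply: incr_valP.
  - move=> N; rewrite -[LHS]/(f (\tr _)) -trace_map_mx rmorphXn /= map_compound ztr.
    by rewrite big_enum_val.
  move=> i; rewrite !normr_prod; apply: ler_prod => j _; rewrite normr_ge0 /=.
  apply: zsort; rewrite /incr_val enum_rankK_in // ffunE.
  exact: (incr_ge (incr_valP i)).
have z0 i : 0 < z i.
  have := zprod i.+1 (ltn_ord i); rewrite big_ord_recr /=.
  rewrite (eq_bigr (fun j => z (widen_ord (ltnW (ltn_ord i)) j))); last first.
    by move=> j _; congr z; apply: val_inj.
  rewrite pmulr_rgt0 ?zprod //; congr (0 < z _); exact: val_inj.
pose lam i := complex.Re (z i).
have zE i : z i = f (lam i).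
  by have := ltW (z0 i); rewrite /lam /f; case: (z i) => x y;
    rewrite lecE /= => /andP[/eqP->].
exists lam; split.
- split.
    apply: (map_poly_inj f).
    rewrite map_char_poly charz rmorph_prod; apply: eq_bigr => i _.
    by rewrite rmorphB /= map_polyX map_polyC /= zE.
  move=> i j leij; have := zsort i j leij.
  by rewrite !gtr0_norm // !zE lecR.
- by move=> i; have := z0 i; rewrite zE ltcR.
move=> k N; apply: (fmorph_inj f).
rewrite -trace_map_mx rmorphXn /= map_compound ztr rmorph_sum.
apply: eq_bigr => h _; rewrite rmorphXn rmorph_prod /=; congr (_ ^+ _).
by apply: eq_bigr => j _; rewrite zE.
Qed.

Local Close Scope complex_scope.

(** * Total nonnegativity of a path-counting array *)

(** Indexing by natural numbers, with a bound [N], lets the size grow in an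
    induction without casts between matrix types. *)
Definition totally_nonnegative (R : numDomainType) (N : nat) (a : nat -> nat -> R) : Prop :=
  forall (k : nat) (f g : 'I_k -> nat),
    {homo f : i j / (i < j)%N} -> {homo g : i j / (i < j)%N} ->
    (forall i, f i < N)%N -> (forall i, g i < N)%N ->
    0 <= \det (\matrix_(i, j) a (f i) (g j)).

Section TotallyNonnegative.
Variable R : numDomainType.
Implicit Types a b : nat -> nat -> R.

Lemma tn_ext N a b : (forall i j, (i < N)%N -> (j < N)%N -> a i j = b i j) ->
  totally_nonnegative N a -> totally_nonnegative N b.
Proof.
move=> eqab tna k f g hf hg fN gN; have := tna k f g hf hg fN gN.
by congr (0 <= \det _); apply/matrixP => i j; rewrite !mxE eqab.
Qed.

Definition add_next_row (l : nat) a : nat -> nat -> R :=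
  fun i j => a i j + (if i == l then a l.+1 j else 0).

(** A minor that uses row [l] splits into a minor of [a] and the one where row
    [l] is replaced by row [l.+1]; the latter still has increasing rows, unless
    it repeats row [l.+1] and vanishes. *)
Lemma tn_add_next_row N l a : (l.+1 < N)%N ->
  totally_nonnegative N a -> totally_nonnegative N (add_next_row l a).
Proof.
move=> lN tna k f g hf hg fN gN.
have [/existsP[i0 /eqP fi0]|/existsPn nol] := boolP [exists i, f i == l]; last first.
  have := tna k f g hf hg fN gN.
  congr (0 <= \det _); apply/matrixP => i j.
  by rewrite !mxE /add_next_row (negPf (nol i)) addr0.
pose f' i := if i == i0 then l.+1 else f i.
have fneq i : i != i0 -> f i == l = false.
  move=> ne; apply/negP => /eqP fil; case: (ltngtP i i0) => [/hf|/hf|/val_inj E].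
  - by rewrite fi0 fil ltnn.
  - by rewrite fi0 fil ltnn.
  - by rewrite E eqxx in ne.
pose A := \matrix_(i, j) add_next_row l a (f i) (g j).
pose B := \matrix_(i, j) a (f i) (g j).
pose C := \matrix_(i, j) a (f' i) (g j).
rewrite -[X in \det X]/A
  (determinant_multilinear (i0 := i0) (B := B) (C := C) (b := 1) (c := 1)).
- rewrite !mul1r addr_ge0 //; first exact: tna.
  have [/existsP[i1 /eqP fi1]|/existsPn nol1] := boolP [exists i, f i == l.+1].
    have ne : i1 != i0 by apply/eqP => E; move: fi1; rewrite E fi0 => /eqP; rewrite ltn_eqF.
    rewrite (determinant_alternate ne) // => j.
    by rewrite !mxE /f' eqxx (negPf ne) fi1.
  apply: tna => // [i j ltij|i]; rewrite /f'; last by case: eqP.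
  case: eqP => [Ei|_]; case: eqP => [Ej|_]; last exact: hf.
  + by rewrite Ei Ej ltnn in ltij.
  + by rewrite ltn_neqAle eq_sym nol1 /= -fi0 -Ei hf.
  + by apply: leq_trans (hf _ _ ltij) _; rewrite Ej fi0.
- by apply/rowP => j; rewrite !mxE /add_next_row fi0 eqxx /f' eqxx !mul1r.
- apply/matrixP => i j; rewrite !mxE /add_next_row fneq ?addr0 //.
  by rewrite eq_sym neq_lift.
- apply/matrixP => i j; rewrite !mxE /add_next_row fneq ?addr0 /f'.
    by rewrite eq_sym (negPf (neq_lift _ _)).
  by rewrite eq_sym neq_lift.
Qed.

Definition prepend1 a : nat -> nat -> R := fun i j =>
  match i, j with
  | 0, 0 => 1
  | i'.+1, j'.+1 => a i' j'
  | _, _ => 0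
  end.

Lemma tn_prepend1 N a : totally_nonnegative N a -> totally_nonnegative N.+1 (prepend1 a).
Proof.
move=> tna [|k] f g hf hg fN gN; first by rewrite det_mx00.
have pos m (h : 'I_m -> nat) : {homo h : i j / (i < j)%N} ->
    forall i : 'I_m, (0 < i)%N -> (0 < h i)%N.
  move=> hh i i0; have m0 : (0 < m)%N by apply: leq_ltn_trans (ltn_ord i).
  by apply: leq_ltn_trans (hh (Ordinal m0) i i0).
have shift m (h1 h2 : 'I_m -> nat) : {homo h1 : i j / (i < j)%N} ->
    {homo h2 : i j / (i < j)%N} -> (forall i, 0 < h1 i <= N)%N ->
    (forall i, 0 < h2 i <= N)%N -> 0 <= \det (\matrix_(i, j) prepend1 a (h1 i) (h2 j)).
  move=> m1 m2 b1 b2; have := tna m (fun i => (h1 i).-1) (fun i => (h2 i).-1).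
  have -> : \matrix_(i, j) a (h1 i).-1 (h2 j).-1 =
      \matrix_(i, j) prepend1 a (h1 i) (h2 j).
    apply/matrixP => i j; rewrite !mxE; have := b1 i; have := b2 j.
    by case: (h1 i) => [|?]; case: (h2 j).
  apply=> [i j ltij|i j ltij|i|i].
  - by have := m1 i j ltij; have := b1 i; lia.
  - by have := m2 i j ltij; have := b2 i; lia.
  - by have := b1 i; lia.
  - by have := b2 i; lia.
have [f0|f0] := posnP (f ord0); have [g0|g0] := posnP (g ord0).
- rewrite (expand_det_row _ ord0) big_ord_recl big1 => [|j _]; last first.
    by rewrite !mxE f0; case: (g _) (pos _ _ hg (lift ord0 j) isT) => // n _; rewrite mul0r.
  rewrite !mxE f0 g0 mul1r addr0 /cofactor addn0 expr0 mul1r.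
  have := shift k (fun i => f (lift ord0 i)) (fun i => g (lift ord0 i)).
  have -> : row' ord0 (col' ord0 (\matrix_(i, j) prepend1 a (f i) (g j))) =
      \matrix_(i, j) prepend1 a (f (lift ord0 i)) (g (lift ord0 j)).
    by apply/matrixP => i j; rewrite !mxE.
  apply=> [i j ltij|i j ltij|i|i].
  - by apply: hf.
  - by apply: hg.
  - by rewrite (pos _ _ hf) //= -ltnS.
  - by rewrite (pos _ _ hg) //= -ltnS.
- rewrite (expand_det_row _ ord0) big1 // => j _; rewrite !mxE f0.
  have : (0 < g j)%N.
    by apply: leq_trans g0 _;
      case: (posnP j) => [/(@val_inj _ _ _ j ord0)->//|/(hg ord0 j)/ltnW].
  by case: (g j) => // n _; rewrite mul0r.
- rewrite (expand_det_col _ ord0) big1 // => j _; rewrite !mxE g0.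
  have : (0 < f j)%N.
    by apply: leq_trans f0 _;
      case: (posnP j) => [/(@val_inj _ _ _ j ord0)->//|/(hf ord0 j)/ltnW].
  by case: (f j) => // n _; rewrite mul0r.
have posall (h : 'I_k.+1 -> nat) : {homo h : i j / (i < j)%N} -> (0 < h ord0)%N ->
    forall i, (0 < h i)%N.
  move=> hh h0 i; apply: leq_trans h0 _.
  by case: (posnP i) => [/(@val_inj _ _ _ i ord0)->//|/(hh ord0 i)/ltnW].
by apply: shift => // i; rewrite posall //= -ltnS.
Qed.

End TotallyNonnegative.

(** The number of lattice paths with unit steps east and north from [(0, l)] to
    [(j, j)]. *)
Definition path_count (l j : nat) : nat := if (l <= j)%N then 'C(j.*2 - l, j) else 0.

(** Splitting the paths by their first step. *)
Lemma path_count_step l j :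
  path_count l.+1 j.+1 = (path_count l j + path_count l.+2 j.+1)%N.
Proof.
rewrite /path_count !ltnS; have [lelj|ltjl] := leqP l j; last by rewrite ltnNge (ltnW ltjl).
have -> : (j.+1.*2 - l.+1 = (j.*2 - l).+1)%N by lia.
rewrite binS addnC; congr addn; case: ltnP => ltlj.
  by congr 'C(_, _); lia.
by rewrite bin_small //; lia.
Qed.

Lemma path_count_step0 j : path_count 0 j.+1 = (2 * path_count 1 j.+1)%N.
Proof.
rewrite /path_count /= subn0.
have -> : (j.+1.*2 - 1 = j.*2.+1)%N by lia.
rewrite doubleS binS mul2n -[RHS]addnn; congr addn.
by rewrite -[RHS]bin_sub; [congr 'C(_, _); lia|lia].
Qed.

(** By [path_count_step], row [l > 0] of the array is the sum of the rows from
    [l] on of the array [Q] obtained by prepending a unit row and column to the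
    array itself; by [path_count_step0], row [0] counts those after the first one
    twice.  These suffix sums are successive additions of the next row. *)
Lemma tn_path_count (R : numDomainType) N :
  totally_nonnegative N (fun l j => (path_count l j)%:R : R).
Proof.
elim: N => [|N IH].
  move=> [|k] f g _ _ fN; first by rewrite det_mx00.
  by have := fN ord0.
pose Q := prepend1 (fun l j => (path_count l j)%:R : R).
have tnQ : totally_nonnegative N.+1 Q by exact: tn_prepend1.
pose suffix s l j := if (s <= l)%N then \sum_(l <= m < N.+1) Q m j else Q l j.
have tn_suffix t : (t <= N)%N -> totally_nonnegative N.+1 (suffix (N - t)%N).
  elim: t => [|t IHt] tN.
    apply: tn_ext tnQ => l j lN jN; rewrite /suffix subn0; case: leqP => // Nl.
    have -> : l = N by lia.
    by rewrite big_nat1.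
  apply: tn_ext (tn_add_next_row (l := (N - t.+1)%N) _ (IHt (ltnW tN))); last by lia.
  move=> l j lN jN; rewrite /add_next_row /suffix.
  have -> : (N - t.+1).+1 = (N - t)%N by lia.
  rewrite leqnn; case: (ltngtP l (N - t.+1)%N) => [ltl|ltl|->].
  - by rewrite addr0 leqNgt (leq_trans ltl) //; lia.
  - by rewrite addr0; have -> : (N - t <= l)%N by lia.
  - have -> : (N - t <= N - t.+1)%N = false by lia.
    rewrite (big_ltn (m := (N - t.+1)%N)); last by lia.
    by have -> : (N - t.+1).+1 = (N - t)%N by lia.
have sumQ l j : (0 < l <= N.+1)%N -> (j < N.+1)%N ->
    \sum_(l <= m < N.+1) Q m j = (path_count l j)%:R.
  move=> /andP[l0 lN] jN; rewrite -(subKn lN); move: (N.+1 - l)%N (subKn lN) => t tE.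
  have {l0 lN tE} tN : (t <= N)%N by lia.
  elim: t tN => [|t IHt] tN.
    by rewrite subn0 big_geq // /path_count leqNgt jN.
  rewrite big_ltn; last by lia.
  have -> : (N.+1 - t.+1).+1 = (N.+1 - t)%N by lia.
  rewrite IHt; last by lia.
  have -> : (N.+1 - t)%N = (N - t).+1 by lia.
  have -> : (N.+1 - t.+1)%N = (N - t.+1).+1 by lia.
  case: j {jN IHt} => [|j] /=; first by rewrite /path_count addr0.
  by rewrite [in RHS]path_count_step natrD (_ : (N - t.+1).+2 = (N - t).+1); last by lia.
case: N => [|N] in IH Q tnQ suffix tn_suffix sumQ *.
  by apply: tn_ext tnQ => [[|l]] [|j].
have tn0 : totally_nonnegative N.+2 (suffix 0%N).
  by rewrite -[X in suffix X](subnn N.+1); exact: tn_suffix.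
(* Row 1 is added to row 0 a second time: this is the factor 2 above. *)
apply: tn_ext (tn_add_next_row (l := 0%N) _ tn0) => // l j lN jN.
rewrite /add_next_row /suffix /=.
case: l lN => [|l] lN /=; last by rewrite sumQ ?addr0 //= ltnW.
rewrite big_ltn // !sumQ //; case: j jN => [|j] jN /=; first by rewrite /path_count !addr0.
by rewrite path_count_step0 add0r -natrD mul2n addnn.
Qed.

(** * Rounding error analysis of subtraction-free formulas *)

Section ErrorFactors.
Variables (R : realType) (u : R).
Hypotheses (u_ge0 : 0 <= u) (u_lt1 : u < 1).

(** With powers of [1 - u] on both sides, the bound is stable under inversion, and
    the exponents add up in products. *)
Definition near1 (a : nat) (f : R) : Prop :=
  (1 - u) ^+ a <= f <= (1 - u) ^- a.

Let q_gt0 : 0 < 1 - u. Proof. by rewrite subr_gt0. Qed.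
Let q_le1 : 1 - u <= 1. Proof. by rewrite gerBl. Qed.
Let qX_gt0 a : 0 < (1 - u) ^+ a. Proof. exact: exprn_gt0. Qed.

Lemma near1_gt0 a f : near1 a f -> 0 < f.
Proof. by case/andP => /(lt_le_trans _) H _; apply: H. Qed.

Lemma near1_1 a : near1 a 1.
Proof. by rewrite /near1 invf_ge1 // !exprn_ile1 // ltW. Qed.

Lemma near1_le a b f : (a <= b)%N -> near1 a f -> near1 b f.
Proof.
move=> leab /andP[f1 f2]; have le_q : (1 - u) ^+ b <= (1 - u) ^+ a.
  by rewrite ler_wiXn2l // ltW.
by rewrite /near1 (le_trans le_q f1) (le_trans f2) // lef_pV2 ?posrE.
Qed.

Lemma near1M a b f g : near1 a f -> near1 b g -> near1 (a + b) (f * g).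
Proof.
move=> Nf Ng; have f0 := near1_gt0 Nf; have g0 := near1_gt0 Ng.
case/andP: Nf => f1 f2; case/andP: Ng => g1 g2.
by rewrite /near1 exprD invfM !ler_pM // ltW.
Qed.

Lemma near1V a f : near1 a f -> near1 a f^-1.
Proof.
move=> Nf; have f0 := near1_gt0 Nf; case/andP: Nf => f1 f2.
by rewrite /near1 lef_pV2 ?posrE // f1 -[_ ^+ a]invrK lef_pV2 ?posrE ?invr_gt0 // f2.
Qed.

(** A square root halves the error; this is what compensates the repeated
    squarings of a matrix. *)
Lemma near1_sqrt a f : near1 a.*2 f -> near1 a (Num.sqrt f).
Proof.
move=> Nf; have f0 := near1_gt0 Nf; case/andP: Nf => f1 f2.
have sqrtq : Num.sqrt ((1 - u) ^+ a.*2) = (1 - u) ^+ a.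
  by rewrite -muln2 exprM sqrtr_sqr gtr0_norm.
by rewrite /near1 -sqrtq -(sqrtrV (ltW (qX_gt0 _))) !ler_wsqrtr.
Qed.

(** A relative perturbation by at most [u] is absorbed by one factor, since
    [1 + u <= (1 - u)^-1]. *)
Lemma near1_round d : `|d| <= u -> near1 1 (1 + d).
Proof.
rewrite ler_norml => /andP[d1 d2]; rewrite /near1 !expr1 lerD2l d1 /=.
rewrite -[_^-1]mul1r ler_pdivlMr //.
have : 0 <= (u - d) * (1 - u) by rewrite mulr_ge0 ?subr_ge0 // ltW.
have := sqr_ge0 u; nra.
Qed.

(** The relative factor of a sum of terms of the same sign is a convex
    combination of theirs, so addition does not amplify errors. *)
Lemma near1_convex a p r f g : 0 <= p * r -> near1 a f -> near1 a g ->
  exists2 h, near1 a h & p * f + r * g = (p + r) * h.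
Proof.
move=> pr0 Nf Ng; have [pr_eq0|ne0] := eqVneq (p + r) 0.
  have /eqP := pr_eq0; rewrite addr_eq0 => /eqP pE.
  have r_eq0 : r = 0.
    by apply/eqP; rewrite -sqrf_eq0 eq_le sqr_ge0 andbT -oppr_ge0 expr2 -mulNr -pE.
  by exists 1; [exact: near1_1 | rewrite pE r_eq0 oppr0 !mul0r addr0 mul0r].
exists (p / (p + r) * f + r / (p + r) * g); last first.
  by rewrite mulrDr !mulrA [_ * p]mulrC [_ * r]mulrC !mulfK.
have s2 : 0 < (p + r) ^+ 2 by rewrite exprn_even_gt0.
have al0 : 0 <= p / (p + r).
  have -> : p / (p + r) = (p ^+ 2 + p * r) / (p + r) ^+ 2 by field.
  by rewrite divr_ge0 ?addr_ge0 ?sqr_ge0.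
have be0 : 0 <= r / (p + r).
  have -> : r / (p + r) = (r ^+ 2 + p * r) / (p + r) ^+ 2 by field.
  by rewrite divr_ge0 ?addr_ge0 ?sqr_ge0.
have : p / (p + r) + r / (p + r) = 1 by rewrite -mulrDl divff.
move: (p / (p + r)) (r / (p + r)) al0 be0 => al be al0 be0 albe.
case/andP: Nf => f1 f2; case/andP: Ng => g1 g2.
rewrite /near1; move: ((1 - u) ^+ a) ((1 - u) ^- a) f1 f2 g1 g2 => x y *.
have {albe}beE : be = 1 - al by lra.
rewrite {}beE in be0 *.
by apply/andP; split; nra.
Qed.

End ErrorFactors.

(** For [u <= 1/2], [(1 - u)^-1 <= 1 + 2 u], and on the unit interval the convex
    function [(1 + y) ^ a] lies below its chord [1 + (2 ^ a - 1) y]. *)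
Lemma near1_dist (R : realType) (u : R) (a : nat) (f : R) :
  0 <= u <= 2^-1 -> near1 u a f -> `|f - 1| <= 2 ^+ a.+1 * u.
Proof.
case/andP => u0 u2 /andP[f1 f2].
have u1 : u < 1 by lra.
have q0 : 0 < (1 - u) ^+ a by rewrite exprn_gt0 // subr_gt0.
have qV : (1 - u) ^- a <= 1 + 2 ^+ a.+1 * u.
  apply: (le_trans (y := (1 + 2 * u) ^+ a)).
    rewrite -exprVn lerXn2r ?nnegrE ?invr_ge0 ?subr_ge0 ?(ltW u1) ?addr_ge0 ?mulr_ge0 //.
    by rewrite -[_^-1]mul1r ler_pdivrMr ?subr_gt0 //; nra.
  have y01 : 0 <= 2 * u <= 1 by apply/andP; split; lra.
  apply: (le_trans (y := 1 + (2 ^+ a - 1) * (2 * u))); last by rewrite exprS; lra.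
  case/andP: y01; move: (2 * u) => y y0 y1.
  elim: a {f1 f2 q0} => [|a IH]; first by rewrite !expr0; lra.
  rewrite exprS; apply: le_trans (ler_wpM2l _ IH) _; first by lra.
  have x1 : 1 <= (2 : R) ^+ a by rewrite exprn_ege1 // ler1n.
  have : 0 <= (2 ^+ a - 1) * (y * (1 - y)) by rewrite !mulr_ge0 ?subr_ge0.
  by rewrite exprS; nra.
(* The lower bound follows from the upper one, as [x + x^-1 >= 2]. *)
have qq : 1 - (1 - u) ^+ a <= (1 - u) ^- a - 1.
  rewrite -subr_ge0; have -> : (1 - u) ^- a - 1 - (1 - (1 - u) ^+ a) =
    (1 - (1 - u) ^+ a) ^+ 2 / (1 - u) ^+ a by field; rewrite gt_eqF.
  by rewrite divr_ge0 ?sqr_ge0 // ltW.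
rewrite ler_norml; apply/andP; split; lra.
Qed.

Lemma computed_eval (R : realType) (I : Type) (u : R) (x : I -> R) (e : expr I) :
  0 <= u -> computed u x e (eval x e).
Proof.
move=> u0; have rnd z : rounding u z z.
  by exists 0; rewrite ?normr0 // addr0 mulr1.
elim: e => //= [a IHa b IHb|a IHa b IHb|a IHa b IHb|a IHa]; last by exists (eval x a).
- by exists (eval x a), (eval x b).
- by exists (eval x a), (eval x b).
- by exists (eval x a), (eval x b).
Qed.

Section Accuracy.
Variables (R : realType) (I : Type) (D : (I -> R) -> Prop).

(** The reference value [p] is the quantity to approximate; it can differ from
    the exact value of a formula.  A truncation error is thereby counted as one more
    rounding error ([accurate_near]). *)
Definition approx (u : R) (a : nat) (p v : R) : Prop :=
  exists2 f, near1 u a f & v = p * f.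

Definition accurate (u : R) (a : nat) (e : expr I) (p : (I -> R) -> R) : Prop :=
  forall x, D x -> admissible x e /\
    forall v, computed u x e v -> approx u a (p x) v.

Section Rules.
Variable u : R.
Hypotheses (u_ge0 : 0 <= u) (u_lt1 : u < 1).
Implicit Types (e : expr I) (p : (I -> R) -> R).

Lemma approx_round a (p w v : R) : approx u a p w -> rounding u w v -> approx u a.+1 p v.
Proof.
move=> [f Nf ->] [d du ->]; exists (f * (1 + d)); last by rewrite mulrA.
by rewrite -addn1; apply: near1M => //; exact: near1_round.
Qed.

Lemma accurate_eval a e p x : accurate u a e p -> D x -> approx u a (p x) (eval x e).
Proof. by move=> He Dx; apply: (He x Dx).2; exact: computed_eval. Qed.

Lemma accurate_data a i : accurate u a (EData i) (fun x => x i).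
Proof.
move=> x _; split=> // v /= ->; exists 1; rewrite ?mulr1 //; exact: near1_1.
Qed.

Lemma accurate_const c : accurate u 1 (EConst I c) (fun=> c%:~R).
Proof.
move=> x _; split=> // v /=; apply: approx_round; exists 1; rewrite ?mulr1 //.
exact: near1_1.
Qed.

Lemma accurate_sub i j : accurate u 1 (ESub i j) (fun x => x i - x j).
Proof.
move=> x _; split=> // v /=; apply: approx_round; exists 1; rewrite ?mulr1 //.
exact: near1_1.
Qed.

Lemma accurate_le a b e p : (a <= b)%N -> accurate u a e p -> accurate u b e p.
Proof.
move=> leab He x Dx; have [ax Hx] := He x Dx; split=> // v /Hx[f Nf ->].
by exists f => //; exact: near1_le Nf.
Qed.

Lemma accurate_mul a b e1 e2 p1 p2 : accurate u a e1 p1 -> accurate u b e2 p2 ->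
  accurate u (a + b).+1 (EMul e1 e2) (fun x => p1 x * p2 x).
Proof.
move=> H1 H2 x Dx; have [a1 C1] := H1 x Dx; have [a2 C2] := H2 x Dx.
split=> // v /= [v1 [v2 [/C1[f1 N1 ->] /C2[f2 N2 ->]]]]; apply: approx_round.
by exists (f1 * f2); [exact: near1M | rewrite mulrACA].
Qed.

Lemma accurate_div a b e1 e2 p1 p2 : accurate u a e1 p1 -> accurate u b e2 p2 ->
  (forall x, D x -> p2 x != 0) ->
  accurate u (a + b).+1 (EDiv e1 e2) (fun x => p1 x / p2 x).
Proof.
move=> H1 H2 nz x Dx; have [a1 C1] := H1 x Dx; have [a2 C2] := H2 x Dx.
split.
  split=> //; have [f Nf ->] := accurate_eval H2 Dx.
  by rewrite mulf_neq0 ?nz // gt_eqF // (near1_gt0 u_lt1 Nf).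
move=> v /= [v1 [v2 [/C1[f1 N1 ->] /C2[f2 N2 ->]]]]; apply: approx_round.
by exists (f1 / f2); [apply: near1M => //; exact: near1V | rewrite invfM mulrACA].
Qed.

Lemma accurate_add a e1 e2 p1 p2 : accurate u a e1 p1 -> accurate u a e2 p2 ->
  (forall x, D x -> 0 <= p1 x * p2 x) ->
  accurate u a.+1 (EAdd e1 e2) (fun x => p1 x + p2 x).
Proof.
move=> H1 H2 sgn x Dx; have [a1 C1] := H1 x Dx; have [a2 C2] := H2 x Dx.
split.
  split=> //; have [f Nf ->] := accurate_eval H1 Dx.
  have [g Ng ->] := accurate_eval H2 Dx.
  rewrite mulrACA mulr_ge0 ?sgn // ltW // mulr_gt0 //.
    exact: (near1_gt0 u_lt1 Nf).
  exact: (near1_gt0 u_lt1 Ng).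
move=> v /= [v1 [v2 [/C1[f1 N1 ->] /C2[f2 N2 ->]]]]; apply: approx_round.
have [h Nh ->] := near1_convex u_ge0 u_lt1 (sgn x Dx) N1 N2.
by exists h.
Qed.

Lemma accurate_sqrt a e p : accurate u a.*2 e p -> (forall x, D x -> 0 <= p x) ->
  accurate u a.+1 (ESqrt e) (fun x => Num.sqrt (p x)).
Proof.
move=> H p0 x Dx; have [ax Cx] := H x Dx.
split.
  split=> //; have [f Nf ->] := accurate_eval H Dx.
  by rewrite mulr_ge0 ?p0 // ltW // (near1_gt0 u_lt1 Nf).
move=> v /= [w /Cx[f Nf ->]]; apply: approx_round.
by exists (Num.sqrt f); [exact: near1_sqrt | rewrite sqrtrM // p0].
Qed.

Lemma accurate_near a b e p r : accurate u a e p ->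
  (forall x, D x -> approx u b (r x) (p x)) -> accurate u (b + a) e r.
Proof.
move=> H near x Dx; have [ax Cx] := H x Dx; split=> // v /Cx[f Nf ->].
have [g Ng ->] := near x Dx.
by exists (g * f); [exact: near1M | rewrite mulrA].
Qed.

End Rules.

Section Computable.
Variables (U : R -> Prop) (sf : bool).
Hypothesis U01 : forall u, U u -> 0 <= u < 1.

(** [U] is the set of roundoffs that a single formula has to serve: all of them
    for a direct algorithm, one for an iterative algorithm.  The flag [sf]
    excludes square roots. *)
Definition computable (a : nat) (p : (I -> R) -> R) : Prop :=
  exists2 e : expr I, sf ==> sqrt_free e & forall u, U u -> accurate u a e p.

Let U0 u : U u -> 0 <= u. Proof. by case/U01/andP. Qed.
Let U1 u : U u -> u < 1. Proof. by case/U01/andP. Qed.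

Lemma computable_ext a p r : (forall x, D x -> p x = r x) ->
  computable a p -> computable a r.
Proof.
move=> eqpr [e se He]; exists e => // u Uu x Dx.
by rewrite -eqpr //; exact: He.
Qed.

Lemma computable_le a b p : (a <= b)%N -> computable a p -> computable b p.
Proof.
by move=> leab [e se He]; exists e => // u Uu; apply: accurate_le (He u Uu); auto.
Qed.

Lemma computable_data a i : computable a (fun x => x i).
Proof. by exists (EData i) => [|u Uu]; [case: sf | apply: accurate_data; auto]. Qed.

Lemma computable_int (c : int) : computable 1 (fun=> c%:~R).
Proof. by exists (EConst I c) => [|u Uu]; [case: sf | apply: accurate_const; auto]. Qed.

Lemma computable_sub i j : computable 1 (fun x => x i - x j).
Proof. by exists (ESub i j) => [|u Uu]; [case: sf | apply: accurate_sub; auto]. Qed.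

Lemma computable_mul a b p r : computable a p -> computable b r ->
  computable (a + b).+1 (fun x => p x * r x).
Proof.
move=> [e se He] [f sf' Hf]; exists (EMul e f) => [|u Uu].
  by move: se sf' => /=; case: sf => //= -> ->.
by apply: accurate_mul; auto.
Qed.

Lemma computable_div a b p r : computable a p -> computable b r ->
  (forall x, D x -> r x != 0) -> computable (a + b).+1 (fun x => p x / r x).
Proof.
move=> [e se He] [f sf' Hf] nz; exists (EDiv e f) => [|u Uu].
  by move: se sf' => /=; case: sf => //= -> ->.
by apply: accurate_div; auto.
Qed.

Lemma computable_add a p r : computable a p -> computable a r ->
  (forall x, D x -> 0 <= p x * r x) -> computable a.+1 (fun x => p x + r x).
Proof.
move=> [e se He] [f sf' Hf] sgn; exists (EAdd e f) => [|u Uu].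
  by move: se sf' => /=; case: sf => //= -> ->.
by apply: accurate_add; auto.
Qed.

Lemma computable_sum (J : eqType) (s : seq J) a (p : J -> (I -> R) -> R) :
  (0 < a)%N -> (forall j, j \in s -> computable a (p j)) ->
  (forall x, D x -> forall i j, i \in s -> j \in s -> 0 <= p i x * p j x) ->
  computable (a + size s) (fun x => \sum_(j <- s) p j x).
Proof.
move=> a0; elim: s => [|j s IH] Hp sgn.
  apply: (@computable_le 1); first by rewrite addn0.
  by apply: computable_ext (computable_int 0) => x _; rewrite big_nil.
apply: (@computable_ext _ (fun x => p j x + \sum_(i <- s) p i x)).
  by move=> x _; rewrite big_cons.
rewrite /= addnS; apply: computable_add.
- by apply: (@computable_le a); [exact: leq_addr | apply: Hp; rewrite mem_head].
- apply: IH => [i si|x Dx i l si sl]; first by apply: Hp; rewrite inE si orbT.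
  by apply: sgn; rewrite // inE ?si ?sl orbT.
- move=> x Dx; rewrite mulr_sumr big_seq; apply: sumr_ge0 => i si.
  by apply: sgn; rewrite // inE ?eqxx ?si ?orbT.
Qed.

End Computable.

Lemma computable_sqrt (U : R -> Prop) a p :
  (forall u, U u -> 0 <= u < 1) ->
  computable U false a.*2 p -> (forall x, D x -> 0 <= p x) ->
  computable U false a.+1 (fun x => Num.sqrt (p x)).
Proof.
move=> U01 [e _ He] p0; exists (ESqrt e) => // u Uu.
by have /andP[u0 u1] := U01 u Uu; apply: accurate_sqrt; auto.
Qed.

Lemma computable_near (U : R -> Prop) sf a b p r :
  (forall u, U u -> 0 <= u < 1) ->
  computable U sf a p ->
  (forall u, U u -> forall x, D x -> approx u b (r x) (p x)) ->
  computable U sf (b + a) r.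
Proof.
move=> U01 [e se He] near; exists e => // u Uu.
by have /andP[u0 u1] := U01 u Uu; apply: accurate_near; auto.
Qed.

End Accuracy.

Section Direct.
Variables (R : realType) (I : Type) (D : (I -> R) -> Prop).
Implicit Types p r : (I -> R) -> R.

Definition unit_roundoff (u : R) : Prop := 0 < u <= 2^-1.

Lemma unit_roundoff01 u : unit_roundoff u -> 0 <= u < 1.
Proof. by case/andP => u0 u2; rewrite ltW //=; lra. Qed.

Definition direct p : Prop := exists a, computable D unit_roundoff true a p.

Let UR := unit_roundoff01.

Lemma direct_ext p r : (forall x, D x -> p x = r x) -> direct p -> direct r.
Proof. by move=> eqpr [a Ha]; exists a; apply: computable_ext eqpr Ha. Qed.

Lemma direct_data i : direct (fun x => x i).
Proof. by exists 0%N; apply: computable_data. Qed.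

Lemma direct_int (c : int) : direct (fun=> c%:~R).
Proof. by exists 1%N; apply: computable_int. Qed.

Lemma direct_nat (c : nat) : direct (fun=> c%:R).
Proof. exact: (direct_int c). Qed.

Lemma direct_sub i j : direct (fun x => x i - x j).
Proof. by exists 1%N; apply: computable_sub. Qed.

Lemma direct_mul p r : direct p -> direct r -> direct (fun x => p x * r x).
Proof. by move=> [a Ha] [b Hb]; exists (a + b).+1; apply: computable_mul. Qed.

Lemma direct_div p r : direct p -> direct r -> (forall x, D x -> r x != 0) ->
  direct (fun x => p x / r x).
Proof. by move=> [a Ha] [b Hb] nz; exists (a + b).+1; apply: computable_div. Qed.

Lemma direct_prod (J : Type) (s : seq J) (P : pred J) (p : J -> (I -> R) -> R) :
  (forall j, P j -> direct (p j)) -> direct (fun x => \prod_(j <- s | P j) p j x).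
Proof.
move=> Hp; elim: s => [|j s IH].
  by apply: direct_ext (direct_nat 1) => x _; rewrite big_nil.
have [Pj|nPj] := boolP (P j).
  by apply: direct_ext (direct_mul (Hp j Pj) IH) => x _; rewrite big_cons Pj.
by apply: direct_ext IH => x _; rewrite big_cons (negPf nPj).
Qed.

Lemma direct_exp p m : direct p -> direct (fun x => p x ^+ m).
Proof.
move=> Hp; have := @direct_prod _ (iota 0 m) xpredT (fun=> p) (fun _ _ => Hp).
apply: direct_ext => x _; elim: m => [|m IH]; first by rewrite big_nil.
by rewrite -addn1 iotaD big_cat /= IH big_seq1 exprD expr1.
Qed.

Lemma direct_sum (J : finType) (P : pred J) (p : J -> (I -> R) -> R) :
  (forall j, P j -> direct (p j)) ->
  (forall x, D x -> forall i j, P i -> P j -> 0 <= p i x * p j x) ->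
  direct (fun x => \sum_(j | P j) p j x).
Proof.
move=> Hp sgn.
have bnd : exists2 a, (0 < a)%N & forall j, P j -> computable D unit_roundoff true a (p j).
  have choice_a j : exists a, P j -> computable D unit_roundoff true a (p j).
    by case: (boolP (P j)) => [/Hp[a Ha]|_]; [exists a | exists 0%N].
  have [a Ha] := fin_all_exists choice_a.
  exists (\max_j a j).+1 => // j /Ha; apply: computable_le => //.
  by apply: leqW; exact: leq_bigmax.
have [a a0 Ha] := bnd; exists (a + size (enum P))%N.
apply: (computable_ext (p := fun x => \sum_(j <- enum P) p j x)).
  by move=> x _; rewrite big_enum.
apply: computable_sum => // [j|x Dx i j]; rewrite ?mem_enum => Pj.
  exact: Ha.
exact: sgn.
Qed.

End Direct.

(** * Generalized Vandermonde determinants *)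

(** Subtracting from each column the right multiple of the previous one clears
    the first row after its first entry.  The remaining entry [(i, j)] becomes
    [y ^ a * (y ^ (b - a) - x0 ^ (b - a))], where [y] is the node of row [i],
    [x0] the first node and [a < b] two consecutive exponents; this is [y - x0]
    times the sum of the [x0 ^ (b - l - 1) * y ^ l] for [a <= l < b].  Since the
    ranges of [l] for successive columns are disjoint and increasing, expanding
    the columns gives only determinants with increasing exponents. *)
Lemma alternant_recursion (F : comNzRingType) (k N : nat) (x : 'I_k.+1 -> F)
    (g : 'I_k.+1 -> nat) :
  {homo g : i j / (i < j)%N} -> (forall j, g j <= N)%N ->
  \det (\matrix_(i, j) x i ^+ g j) =
  x ord0 ^+ g ord0 * (\prod_(i < k) (x (lift ord0 i) - x ord0)) *
  \sum_(m : {ffun 'I_k -> 'I_N} |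
        [forall j, g (widen_ord (leqnSn k) j) <= m j < g (lift ord0 j)]%N)
    (\prod_j x ord0 ^+ (g (lift ord0 j) - (m j).+1)) *
    \det (\matrix_(i, j) x (lift ord0 i) ^+ m j).
Proof.
move=> hg gN; set A := \matrix_(i, j) _.
pose pr := widen_ord (leqnSn k).
pose c (j : 'I_k) := x ord0 ^+ (g (lift ord0 j) - g (pr j)).
have ltg j : (g (pr j) < g (lift ord0 j))%N by apply: hg.
pose T : 'M[F]_k.+1 := \matrix_(l, j) ((l == j)%:R -
  (if unlift ord0 j is Some j' then (l == pr j')%:R * c j' else 0)).
have detT : \det T = 1.
  rewrite -det_tr det_trig.
    rewrite big1 // => i _; rewrite !mxE eqxx;
      case: unliftP => [j' ->|_]; last by rewrite subr0.
    by rewrite -val_eqE /= /bump /= add1n gtn_eqF // mul0r subr0.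
  apply/is_trig_mxP => i j ltij; rewrite !mxE -val_eqE gtn_eqF //.
  case: unliftP => [j' Ej|_]; last by rewrite subr0.
  rewrite -val_eqE gtn_eqF ?mul0r ?subr0 //=.
  by move: ltij; rewrite Ej /= /bump /= add1n => /ltnW.
have AT i j : (A *m T) i j =
    x i ^+ g j - (if unlift ord0 j is Some j' then x i ^+ g (pr j') * c j' else 0).
  rewrite mxE; under eq_bigr => l _ do rewrite !mxE mulrBr.
  rewrite sumrB; congr (_ - _).
    by rewrite (bigD1 j) //= eqxx mulr1 big1 ?addr0 // => l /negPf ->; rewrite mulr0.
  case: unliftP => [j' _|_]; last by rewrite big1 // => l _; rewrite mulr0.
  rewrite (bigD1 (pr j')) //= eqxx mul1r big1 ?addr0 // => l /negPf ->.
  by rewrite mul0r mulr0.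
have -> : \det A = \det (A *m T) by rewrite det_mulmx detT mulr1.
rewrite (expand_det_row _ ord0) big_ord_recl big1 ?addr0; last first.
  move=> j _; rewrite AT liftK -exprD subnKC ?subrr ?mul0r //; exact: ltnW.
rewrite AT unlift_none subr0 -mulrA; congr (_ * _).
rewrite /cofactor addn0 expr0 mul1r.
pose X : 'M[F]_(N, k) := \matrix_(m, i) x (lift ord0 i) ^+ m.
pose W : 'M[F]_(k, N) := \matrix_(j, m)
  (if (g (pr j) <= m < g (lift ord0 j))%N then x ord0 ^+ (g (lift ord0 j) - m.+1) else 0).
have -> : row' ord0 (col' ord0 (A *m T)) =
    diag_mx (\row_i (x (lift ord0 i) - x ord0)) *m (W *m X)^T.
  apply/matrixP => i j.
  transitivity ((A *m T) (lift ord0 i) (lift ord0 j)); first by rewrite !mxE.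
  rewrite AT liftK mul_diag_mx !mxE.
  under [in RHS]eq_bigr => l _ do rewrite !mxE.
  rewrite /c; move: (x (lift ord0 i)) (x ord0) (ltg j) (gN (lift ord0 j)) => y x0.
  move: (g (lift ord0 j)) (g (pr j)) => b a ltab lebN /=.
  rewrite -(big_mkord xpredT (fun l =>
    (if (a <= l < b)%N then x0 ^+ (b - l.+1) else 0) * y ^+ l)).
  rewrite (bigID (fun l => a <= l < b)%N) /= [X in _ * (_ + X)]big1 ?addr0; last first.
    by move=> l /negPf ->; rewrite mul0r.
  under eq_bigr => l -> do [].
  have -> : \sum_(0 <= l < N | (a <= l < b)%N) x0 ^+ (b - l.+1) * y ^+ l =
      \sum_(a <= l < b) x0 ^+ (b - l.+1) * y ^+ l.
    by rewrite (big_nat_widenl a 0) // (big_nat_widen _ b N).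
  have -> : y ^+ b - y ^+ a * x0 ^+ (b - a) = y ^+ a * (y ^+ (b - a) - x0 ^+ (b - a)).
    by rewrite mulrBr -exprD subnKC // ltnW.
  rewrite -[y ^+ _ - _]opprB subrXX -mulNr opprB mulrCA; congr (_ * _).
  rewrite -[X in \sum_(X <= _ < _) _]add0n big_addn big_mkord mulr_sumr.
  apply: eq_bigr => l _; rewrite mulrCA -exprD addnC; congr (x0 ^+ _ * _); lia.
rewrite det_mulmx det_diag det_tr; congr (_ * _).
  by apply: eq_bigr => i _; rewrite mxE.
rewrite det_mulmx_expand (bigID (fun m : {ffun 'I_k -> 'I_N} =>
  [forall j, g (pr j) <= m j < g (lift ord0 j)]%N)) /=.
rewrite [X in _ + X]big1 ?addr0 => [|m /forallPn[j nj]]; last first.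
  by rewrite (bigD1 j) //= mxE (negPf nj) !mul0r.
apply: eq_bigr => m /forallP inm; congr (_ * _).
  by apply: eq_bigr => j _; rewrite mxE inm.
rewrite -det_tr; congr (\det _); apply/matrixP => i j; by rewrite !mxE.
Qed.

(** The nodes are only part of the data, selected by [t]: for linear systems the
    right-hand side is the rest. *)
Definition ascending (R : realType) (I : Type) (D : (I -> R) -> Prop) (k : nat)
    (t : 'I_k -> I) : Prop :=
  forall x, D x -> positive_increasing (x \o t).

Lemma alternant_gt0_direct (R : realType) (I : Type) (D : (I -> R) -> Prop)
    (k : nat) (t : 'I_k -> I) (g : 'I_k -> nat) :
  ascending D t -> {homo g : i j / (i < j)%N} ->
  (forall x, D x -> 0 < \det (\matrix_(i, j) x (t i) ^+ g j)) /\
  direct D (fun x => \det (\matrix_(i, j) x (t i) ^+ g j)).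
Proof.
elim: k => [|k IH] in t g *; move=> asc hg.
  split=> [x _|]; first by rewrite det_mx00.
  by apply: direct_ext (direct_nat D 1) => x _; rewrite det_mx00.
pose N := (\max_j g j)%N.
have gN j : (g j <= N)%N by exact: leq_bigmax.
pose tl (i : 'I_k) := t (lift ord0 i).
have asc_tl : ascending D tl.
  move=> x /asc[pos inc]; split=> [i|i j ltij]; first exact: pos.
  by apply: inc.
pose P (m : {ffun 'I_k -> 'I_N}) :=
  [forall j, g (widen_ord (leqnSn k) j) <= m j < g (lift ord0 j)]%N.
have Pincr (m : {ffun 'I_k -> 'I_N}) : P m -> {homo (fun j => m j : nat) : i j / (i < j)%N}.
  move=> /forallP Pm i j ltij; have /andP[_ lt1] := Pm i; have /andP[le2 _] := Pm j.
  apply: leq_trans lt1 (leq_trans _ le2).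
  have [E|ne] := eqVneq (lift ord0 i) (widen_ord (leqnSn k) j); first by rewrite E.
  apply/ltnW/hg; rewrite ltn_neqAle val_eqE ne /= /bump /=; exact: ltij.
have pos0 x : D x -> 0 < x (t ord0) by move=> /asc[pos _]; exact: pos.
have diff x i : D x -> 0 < x (t (lift ord0 i)) - x (t ord0).
  by move=> /asc[_ inc]; rewrite subr_gt0; apply: inc.
have term_gt0 x m : D x -> P m ->
    0 < (\prod_j x (t ord0) ^+ (g (lift ord0 j) - (m j).+1)) *
        \det (\matrix_(i, j) x (tl i) ^+ m j).
  move=> Dx Pm; rewrite mulr_gt0 ?prodr_gt0 // => [j _|].
    by rewrite exprn_gt0 // pos0.
  by have [H _] := IH tl (fun j => m j) asc_tl (Pincr m Pm); exact: H.
have ltgN (j : 'I_k) : (g (widen_ord (leqnSn k) j) < N)%N.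
  by apply: leq_trans (gN (lift ord0 j)); apply: hg; rewrite /= /bump.
pose m0 : {ffun 'I_k -> 'I_N} := [ffun j => Ordinal (ltgN j)].
have Pm0 : P m0.
  by apply/forallP => j; rewrite ffunE /= leqnn /=; apply: hg; rewrite /= /bump.
split=> [x Dx|].
  rewrite (alternant_recursion _ hg gN) !mulr_gt0 //.
  - by rewrite exprn_gt0 // pos0.
  - by apply: prodr_gt0 => i _; exact: diff.
  rewrite (bigD1 m0) //= ltr_pwDl ?term_gt0 //.
  by apply: sumr_ge0 => m /andP[Pm _]; rewrite ltW // term_gt0.
have D0 : direct D (fun x => x (t ord0)) := direct_data D (t ord0).
apply: (direct_ext (p := fun x =>
  x (t ord0) ^+ g ord0 * (\prod_(i < k) (x (t (lift ord0 i)) - x (t ord0))) *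
  \sum_(m | P m) (\prod_j x (t ord0) ^+ (g (lift ord0 j) - (m j).+1)) *
    \det (\matrix_(i, j) x (tl i) ^+ m j))).
  by move=> x Dx; rewrite (alternant_recursion _ hg gN).
apply: direct_mul; first apply: direct_mul.
- exact: direct_exp.
- by apply: direct_prod => i _; exact: direct_sub.
apply: direct_sum => [m Pm|x Dx m m' Pm Pm']; last by rewrite mulr_ge0 // ltW // term_gt0.
apply: direct_mul; first by apply: direct_prod => j _; exact: direct_exp.
by have [_ H] := IH tl (fun j => m j) asc_tl (Pincr m Pm).
Qed.

(** * Minors of the reverse Bessel matrix *)

Section BesselFactorization.
Variable R : realType.

(** The coefficient of degree [l] of the [j]-th polynomial ([bessel_coefE]),
    written as a row factor, a path count and a column factor. *)
Definition bessel_coef (l j : nat) : R :=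
  2 ^+ l / l`!%:R * (path_count l j)%:R * (j`!%:R / 2 ^+ j).

Lemma bessel_coefE (l j : nat) : (l <= j)%N ->
  bessel_coef l j = (j.*2 - l)`!%:R / (2 ^+ (j - l) * l`!%:R * (j - l)`!%:R).
Proof.
move=> lelj; rewrite /bessel_coef /path_count lelj.
have <- : ('C(j.*2 - l, j) * (j`! * (j - l)`!) = (j.*2 - l)`!)%N.
  have -> : (j - l = j.*2 - l - j)%N by lia.
  by rewrite bin_fact //; lia.
have nz m : m`!%:R != 0 :> R by rewrite pnatr_eq0 -lt0n fact_gt0.
have nz2 m : 2 ^+ m != 0 :> R by rewrite expf_neq0 // pnatr_eq0.
rewrite -[in 2 ^+ j](subnK lelj) exprD !natrM.
by field; rewrite !nz !nz2.
Qed.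

Lemma rev_bessel_horner (N j : nat) (y : R) : (j < N)%N ->
  (rev_bessel R j).[y] = \sum_(l < N) y ^+ l * bessel_coef l j.
Proof.
move=> jN; rewrite /rev_bessel horner_sum.
rewrite (reindex_inj rev_ord_inj) /=.
rewrite -(big_mkord xpredT (fun l => y ^+ l * bessel_coef l j)).
rewrite (big_cat_nat _ jN) //= [X in _ + X]big1_seq ?addr0; last first.
  move=> l /=; rewrite mem_index_iota => /andP[jl _].
  by rewrite /bessel_coef /path_count leqNgt jl !(mul0r, mulr0).
rewrite big_mkord; apply: eq_bigr => l _; rewrite hornerZ hornerXn mulrC subSS.
have lelj : (l <= j)%N by rewrite -ltnS.
rewrite subKn // bessel_coefE //.
by have -> : (j.*2 - l = j + (j - l))%N by lia.
Qed.

Lemma bessel_mx_factor (n : nat) (t : 'I_n -> R) :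
  bessel_mx t =
  (\matrix_(i < n, l < n) t i ^+ l) *m (\matrix_(l < n, j < n) bessel_coef l j).
Proof.
apply/matrixP => i j; rewrite !mxE (rev_bessel_horner _ (ltn_ord j)).
by apply: eq_bigr => l _; rewrite !mxE.
Qed.

Lemma det_bessel_coef (k : nat) (f g : 'I_k -> nat) :
  \det (\matrix_(i, j) bessel_coef (f i) (g j)) =
  (\prod_i (2 ^+ f i / (f i)`!%:R)) *
  \det (\matrix_(i, j) (path_count (f i) (g j))%:R) *
  \prod_j ((g j)`!%:R / 2 ^+ g j).
Proof.
have -> : \matrix_(i, j) bessel_coef (f i) (g j) =
    diag_mx (\row_i (2 ^+ f i / (f i)`!%:R)) *m
    \matrix_(i, j) (path_count (f i) (g j))%:R *m
    diag_mx (\row_j ((g j)`!%:R / 2 ^+ g j)).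
  by apply/matrixP => i j; rewrite mul_mx_diag [RHS]mxE mul_diag_mx !mxE.
rewrite !det_mulmx !det_diag; congr (_ * _ * _); apply: eq_bigr => i _; by rewrite mxE.
Qed.

Lemma det_bessel_coef_ge0 (k : nat) (f g : 'I_k -> nat) :
  {homo f : i j / (i < j)%N} -> {homo g : i j / (i < j)%N} ->
  0 <= \det (\matrix_(i, j) bessel_coef (f i) (g j)).
Proof.
move=> hf hg; rewrite det_bessel_coef mulr_ge0 ?mulr_ge0 ?prodr_ge0 // => [i _||j _].
- by rewrite divr_ge0 ?exprn_ge0.
- apply: (@tn_path_count R (\max_i f i + \max_i g i).+1) => // i; rewrite ltnS.
    by apply: leq_trans (leq_addr _ _); exact: leq_bigmax.
  by apply: leq_trans (leq_addl _ _); exact: leq_bigmax.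
- by rewrite divr_ge0 ?exprn_ge0.
Qed.

Lemma det_bessel_coef_diag (k : nat) (g : 'I_k -> nat) :
  {homo g : i j / (i < j)%N} ->
  0 < \det (\matrix_(i, j) bessel_coef (g i) (g j)).
Proof.
move=> hg; rewrite -det_tr det_trig.
  apply: prodr_gt0 => i _; rewrite !mxE /bessel_coef /path_count leqnn.
  have -> : ((g i).*2 - g i = g i)%N by lia.
  by rewrite binn !mulr_gt0 ?invr_gt0 ?exprn_gt0 ?ltr0n ?fact_gt0.
apply/is_trig_mxP => i j ltij; rewrite !mxE /bessel_coef /path_count leqNgt hg //=.
by rewrite mulr0 mul0r.
Qed.

Lemma direct_det_bessel_coef (I : Type) (D : (I -> R) -> Prop) (k : nat)
    (f g : 'I_k -> nat) :
  direct D (fun=> \det (\matrix_(i, j) bessel_coef (f i) (g j))).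
Proof.
have pow2 m : direct D (fun=> 2 ^+ m : R) by exact/direct_exp/direct_nat.
have nz m : m`!%:R != 0 :> R by rewrite pnatr_eq0 -lt0n fact_gt0.
have nz2 m : 2 ^+ m != 0 :> R by rewrite expf_neq0 // pnatr_eq0.
apply: (direct_ext (p := fun=> (\prod_i (2 ^+ f i / (f i)`!%:R)) *
  (\det (\matrix_(i, j) (path_count (f i) (g j))%:Z))%:~R *
  \prod_j ((g j)`!%:R / 2 ^+ g j))).
  move=> _ _; rewrite det_bessel_coef -(det_map_mx (intr : int -> R)); do 2 congr (_ * _).
  by congr (\det _); apply/matrixP => i j; rewrite !mxE.
apply: direct_mul; first apply: direct_mul.
- by apply: direct_prod => i _; apply: direct_div => //; exact: direct_nat.
- exact: direct_int.
- by apply: direct_prod => i _; apply: direct_div => //; exact: direct_nat.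
Qed.

End BesselFactorization.

(** The only property of a matrix that the algorithms use. *)
Definition direct_minors (R : realType) (I : Type) (D : (I -> R) -> Prop) (m n : nat)
    (B : (I -> R) -> 'M[R]_(m, n)) : Prop :=
  forall k (f : 'I_k -> 'I_m) (g : 'I_k -> 'I_n), incr f -> incr g ->
    (forall x, D x -> 0 < \det (mxsub f g (B x))) /\
    direct D (fun x => \det (mxsub f g (B x))).

(** All the terms of the Cauchy-Binet expansion are nonnegative, and the one that
    selects the rows [g] of the coefficients is positive because the coefficient
    matrix is triangular. *)
Lemma bessel_minors (R : realType) (I : Type) (D : (I -> R) -> Prop) (n : nat)
    (t : 'I_n -> I) :
  ascending D t -> direct_minors D (fun x => bessel_mx (x \o t)).
Proof.
move=> asc k f g hf hg.
pose V (h : {ffun 'I_k -> 'I_n}) x := \det (\matrix_(i, j) x (t (f i)) ^+ h j) : R.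
pose C (h : {ffun 'I_k -> 'I_n}) := \det (\matrix_(i, j) bessel_coef R (h i) (g j)).
have minorE x : \det (mxsub f g (bessel_mx (x \o t))) = \sum_(h in incrs k n) V h x * C h.
  rewrite bessel_mx_factor det_mxsub_mulmx; apply: eq_bigr => h _.
  by congr (_ * _); congr (\det _); apply/matrixP => i j; rewrite !mxE.
have asc_f : ascending D (t \o f).
  move=> x /asc[pos inc]; split=> [i|i j ltij]; first exact: pos.
  by apply: inc; apply: (incrP _ hf).
have HV h : h \in incrs k n -> (forall x, D x -> 0 < V h x) /\ direct D (V h).
  by rewrite inE => /incrP hh; apply: (alternant_gt0_direct asc_f).
have HC h : h \in incrs k n -> 0 <= C h.
  by rewrite inE => /incrP hh; apply: det_bessel_coef_ge0 => //; exact/incrP.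
split=> [x Dx|].
  pose g' : {ffun 'I_k -> 'I_n} := [ffun i => g i].
  have ing' : g' \in incrs k n.
    by rewrite inE; apply/incrP => i j; rewrite !ffunE; exact: (incrP _ hg).
  rewrite minorE (bigD1 g') //= ltr_pwDl //; last first.
    by apply: sumr_ge0 => h /andP[/[dup] /HV[Vh _] /HC Ch]; rewrite mulr_ge0 ?Vh // ltW ?Vh.
  have [Vg _] := HV _ ing'; rewrite mulr_gt0 ?Vg //.
  have := @det_bessel_coef_diag R k (fun i => g i) (incrP _ hg).
  by congr (0 < \det _); apply/matrixP => i j; rewrite !mxE ffunE.
apply: direct_ext (fun x _ => esym (minorE x)) _; apply: direct_sum => [h /HV[_ dV]|].
  by apply: direct_mul => //; exact: direct_det_bessel_coef.
move=> x Dx h h' /[dup] /HC Ch /HV[Vh _] /[dup] /HC Ch' /HV[Vh' _].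
by rewrite !mulr_ge0 // ltW ?Vh ?Vh'.
Qed.

Lemma gram_minors (R : realType) (I : Type) (D : (I -> R) -> Prop) (m n : nat)
    (B : (I -> R) -> 'M[R]_(m, n)) :
  (n <= m)%N -> direct_minors D B -> direct_minors D (fun x => (B x)^T *m B x).
Proof.
move=> lenm HB k f g hf hg.
pose G (h : {ffun 'I_k -> 'I_m}) x := \det (mxsub h f (B x)) * \det (mxsub h g (B x)).
have minorE x : \det (mxsub f g ((B x)^T *m B x)) = \sum_(h in incrs k m) G h x.
  rewrite det_mxsub_mulmx; apply: eq_bigr => h _; rewrite /G; congr (_ * _).
  by rewrite -det_tr; congr (\det _); apply/matrixP => i j; rewrite !mxE.
have HG h : h \in incrs k m -> (forall x, D x -> 0 < G h x) /\ direct D (G h).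
  rewrite inE => hh; have [p1 d1] := HB k h f hh hf; have [p2 d2] := HB k h g hh hg.
  by split=> [x Dx|]; [rewrite mulr_gt0 ?p1 ?p2 | apply: direct_mul].
split=> [x Dx|].
  pose w : {ffun 'I_k -> 'I_m} := [ffun i => widen_ord lenm (f i)].
  have inw : w \in incrs k m.
    by rewrite inE; apply/incrP => i j; rewrite !ffunE; exact: (incrP _ hf).
  rewrite minorE (bigD1 w) //= ltr_pwDl ?(HG w inw).1 //.
  by apply: sumr_ge0 => h /andP[/HG[Gh _] _]; rewrite ltW ?Gh.
apply: direct_ext (fun x _ => esym (minorE x)) _; apply: direct_sum => [h /HG[]//|].
by move=> x Dx h h' /HG[Gh _] /HG[Gh' _]; rewrite mulr_ge0 // ltW ?Gh ?Gh'.
Qed.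

(** * Iterative computation of eigenvalues *)

Section Iterations.
Variables (R : realType) (I : Type) (D : (I -> R) -> Prop).

(** The formula can depend on [u], but the number [a] of error factors cannot. *)
Definition iterative (p : (I -> R) -> R) : Prop :=
  exists a, forall u, unit_roundoff u -> computable D (eq u) false a p.

Lemma eq_roundoff01 u : unit_roundoff u -> forall v : R, u = v -> 0 <= v < 1.
Proof. by move=> /unit_roundoff01 u01 _ <-. Qed.

Lemma iterative_div p r : iterative p -> iterative r ->
  (forall x, D x -> r x != 0) -> iterative (fun x => p x / r x).
Proof.
move=> [a Ha] [b Hb] nz; exists (a + b).+1 => u uu.
by apply: computable_div; auto; exact: eq_roundoff01.
Qed.

Lemma iterative_sqrt p : iterative p -> (forall x, D x -> 0 <= p x) ->
  iterative (fun x => Num.sqrt (p x)).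
Proof.
move=> [a Ha] p0; exists a.+1 => u uu.
apply: computable_sqrt => //; first exact: eq_roundoff01.
by apply: computable_le (Ha u uu); [exact: eq_roundoff01 | lia].
Qed.

Section FixedRoundoff.
Variable u : R.
Hypothesis uu : unit_roundoff u.
Let u01 := eq_roundoff01 uu.

Lemma computable_square_mx m a (X : (I -> R) -> 'M[R]_m) : (0 < a)%N ->
  (forall x, D x -> forall i j, 0 <= X x i j) ->
  (forall i j, computable D (eq u) false a (fun x => X x i j)) ->
  forall i j, computable D (eq u) false (a.*2 + m.+1) (fun x => (X x *m X x) i j).
Proof.
move=> a0 X0 HX i j.
apply: (computable_ext (p := fun x => \sum_(l <- index_enum 'I_m) X x i l * X x l j)).
  by move=> x _; rewrite mxE.
have -> : (a.*2 + m.+1 = (a + a).+1 + size (index_enum 'I_m))%N.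
  by rewrite -addnn addnS addSn; congr (_ + _).+1; rewrite -[LHS]card_ord cardE enumT.
apply: computable_sum => // [l _|x Dx l l' _ _]; first exact: computable_mul.
by rewrite !mulr_ge0 ?X0.
Qed.

(** Each squaring sends the number [w] of error factors to [2 * w + m.+1], so
    that [w + m.+1] doubles. *)
Lemma computable_power_mx m a (X : (I -> R) -> 'M[R]_m) t : (0 < a)%N ->
  (forall x, D x -> forall i j, 0 <= X x i j) ->
  (forall i j, computable D (eq u) false a (fun x => X x i j)) ->
  forall i j, computable D (eq u) false (2 ^ t * (a + m.+1) - m.+1)
    (fun x => (X x ^+ (2 ^ t)) i j).
Proof.
move=> a0 X0 HX; elim: t => [|t IH] i j.
  by rewrite mul1n addnK; apply: HX.
have pos : (0 < 2 ^ t)%N by rewrite expn_gt0.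
apply: (computable_ext (p := fun x => (X x ^+ (2 ^ t) *m X x ^+ (2 ^ t)) i j)).
  by move=> x _; rewrite mulmxE -exprD addnn -mul2n -expnS.
apply: computable_le (computable_square_mx _ _ IH i j); first exact: u01.
- by rewrite expnS; nia.
- by nia.
- by move=> x Dx i' j'; rewrite expmx_ge0 // => *; exact: X0.
Qed.

(** The summand [2] is the fixed point of [c => c / 2 + 1], one rounding per
    square root. *)
Lemma computable_iter_sqrt w t p :
  (forall x, D x -> 0 <= p x) ->
  computable D (eq u) false (2 ^ t * w + 2) p ->
  computable D (eq u) false (w + 2) (fun x => iter t Num.sqrt (p x)).
Proof.
elim: t p => [|t IH] p p0 Hp; first by rewrite mul1n in Hp.
apply: (computable_ext (p := fun x => iter t Num.sqrt (Num.sqrt (p x)))).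
  by move=> x _; rewrite iterSr.
apply: IH => [x Dx|]; first exact: sqrtr_ge0.
have -> : (2 ^ t * w + 2 = (2 ^ t * w + 1).+1)%N by lia.
apply: computable_sqrt => //.
by apply: computable_le Hp; [exact: u01 | rewrite expnS; lia].
Qed.

End FixedRoundoff.

Lemma iter_sqrt_exp t (y : R) : 0 <= y ->
  0 <= iter t Num.sqrt y /\ iter t Num.sqrt y ^+ (2 ^ t) = y.
Proof.
elim: t y => [|t IH] y y0; first by [].
have [r0 rE] := IH _ (sqrtr_ge0 y).
by rewrite iterSr; split=> //; rewrite expnS mulnC exprM rE sqr_sqrtr.
Qed.

(** An [N]-th root with [m <= N * u] turns the factor [m] into a single rounding
    error, since [m <= (1 + u) ^ N] by Bernoulli's inequality. *)
Lemma root_near (u y r : R) (m N : nat) :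
  unit_roundoff u -> 0 < y -> 0 <= r -> (0 < N)%N -> m%:R <= N%:R * u ->
  y ^+ N <= r ^+ N <= m%:R * y ^+ N -> approx u 1 y r.
Proof.
move=> uu y0 r0 N0 mN /andP[yr ry]; have /andP[u0 u2] := uu.
have /andP[_ u1] := unit_roundoff01 uu.
have q0 : 0 < 1 - u by rewrite subr_gt0.
exists (r / y); last by rewrite mulrC divfK // gt_eqF.
rewrite /near1 !expr1; apply/andP; split.
  apply: (le_trans (y := 1)); first by rewrite gerBl ltW.
  by rewrite ler_pdivlMr // mul1r -(ler_pXn2r N0) ?nnegrE // ltW.
rewrite -(ler_pXn2r N0) ?nnegrE ?divr_ge0 ?invr_ge0 ?(ltW y0) ?(ltW q0) //.
rewrite expr_div_n ler_pdivrMr ?exprn_gt0 //.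
apply: le_trans ry _; rewrite ler_wpM2r ?exprn_ge0 ?(ltW y0) //.
apply: le_trans mN _; apply: (le_trans (y := (1 + u) ^+ N)).
  by apply: le_trans (bernoulli N (ltW u0)); rewrite lerDr.
rewrite lerXn2r ?nnegrE ?invr_ge0 ?(ltW q0) ?addr_ge0 ?(ltW u0) //.
rewrite -[_^-1]mul1r ler_pdivlMr //; have := sqr_ge0 u; nra.
Qed.

Variable n : nat.
Variable B : (I -> R) -> 'M[R]_n.
Hypothesis HB : direct_minors D B.
Variable lam : (I -> R) -> 'I_n -> R.
Hypothesis lam_gt0 : forall x, D x -> forall i, 0 < lam x i.
Hypothesis lam_sorted : forall x, D x ->
  forall i j : 'I_n, (i <= j)%N -> lam x j <= lam x i.
Hypothesis lam_traces : forall x, D x -> forall k N,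
  \tr (compound k (B x) ^+ N) = \sum_(h in incrs k n) (\prod_j lam x (h j)) ^+ N.

(** The trace of the [N]-th power of the compound is a sum of [m] terms, the
    largest of which is the [N]-th power of the leading product. *)
Lemma iterative_leading_product k (lekn : (k <= n)%N) :
  iterative (fun x => \prod_(i < k) lam x (widen_ord lekn i)).
Proof.
pose m := #|incrs k n|; pose X x := compound k (B x).
pose y x := \prod_(i < k) lam x (widen_ord lekn i).
pose w : {ffun 'I_k -> 'I_n} := [ffun i => widen_ord lekn i].
have inw : w \in incrs k n by rewrite inE; apply/incrP => i j; rewrite !ffunE.
have yE x : y x = \prod_j lam x (w j) by apply: eq_bigr => j _; rewrite ffunE.
have y0 x : D x -> 0 < y x by move=> Dx; apply: prodr_gt0 => i _; exact: lam_gt0.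
have minors i j := HB (incr_valP i : incr (incr_val i)) (incr_valP j : incr (incr_val j)).
have X0 x : D x -> forall i j, 0 <= X x i j.
  by move=> Dx i j; rewrite mxE ltW // (minors k i j).1.
have [a [a0 Ha]] : exists a, (0 < a)%N /\
    forall u, unit_roundoff u -> forall i j, computable D (eq u) false a (fun x => X x i j).
  have dX (ij : 'I_m * 'I_m) : exists a, computable D (@unit_roundoff R) true a
      (fun x => X x ij.1 ij.2).
    have [_ [a Ha]] := minors k ij.1 ij.2; exists a.
    by apply: computable_ext Ha => x _; rewrite mxE.
  have [a Ha] := fin_all_exists dX.
  exists (\max_ij a ij).+1; split=> // u uu i j.
  have [e _ He] := Ha (i, j).
  have He' : computable D (eq u) false (a (i, j)) (fun x => X x i j).
    by exists e => // _ <-; exact: He.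
  by apply: computable_le He'; [exact: eq_roundoff01 | apply/leqW/leq_bigmax].
pose c := (a + m.+1)%N.
exists (1 + (c + 2))%N => u uu; have /andP[u0 u2] := uu.
have u01 := eq_roundoff01 uu.
pose t := Num.bound (m%:R / u).
have tP : m%:R <= (2 ^ t)%:R * u.
  rewrite -ler_pdivrMr //; apply: ltW; apply: lt_trans (_ : t%:R < _).
    by apply: archi_boundP; rewrite divr_ge0 // ltW.
  by rewrite ltr_nat ltn_expl.
pose tau x := \tr (X x ^+ (2 ^ t)).
have tauE x : D x -> tau x = \sum_(h in incrs k n) (\prod_j lam x (h j)) ^+ (2 ^ t).
  by move=> Dx; rewrite /tau lam_traces.
have prod_ge0 x (h : {ffun 'I_k -> 'I_n}) : D x -> 0 <= \prod_j lam x (h j).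
  by move=> Dx; apply: prodr_ge0 => j _; rewrite ltW ?lam_gt0.
have tau0 x : D x -> 0 <= tau x.
  by move=> Dx; rewrite tauE //; apply: sumr_ge0 => h _; rewrite exprn_ge0 ?prod_ge0.
apply: (computable_near (p := fun x => iter t Num.sqrt (tau x))) => // [|v Ev x Dx].
  apply: computable_iter_sqrt => //.
  apply: (computable_ext (p := fun x => \sum_(i <- index_enum 'I_m) (X x ^+ (2 ^ t)) i i)).
    by [].
  have pos : (0 < 2 ^ t)%N by rewrite expn_gt0.
  have size_m : size (index_enum 'I_m) = m by rewrite -[RHS]card_ord cardE enumT.
  apply: (computable_le u01 (a := (2 ^ t * c - m.+1 + size (index_enum 'I_m))%N)).
    by rewrite size_m /c; nia.
  apply: computable_sum => // [|i _|x Dx i j _ _]; first by rewrite /c; nia.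
    by apply: (computable_power_mx uu) => [||? ?]; [exact: a0 | exact: X0 | exact: Ha].
  by rewrite mulr_ge0 ?expmx_ge0 //; exact: X0.
rewrite -Ev; have [r0 rE] := iter_sqrt_exp t (tau0 x Dx).
apply: (root_near (m := m) (N := 2 ^ t)) => //; rewrite ?y0 ?expn_gt0 //.
rewrite rE tauE //; apply/andP; split.
  rewrite (bigD1 w) //= -yE lerDl; apply: sumr_ge0 => h _.
  by rewrite exprn_ge0 ?prod_ge0.
rewrite /m -sum1_card natr_sum mulr_suml; apply: ler_sum => h inh; rewrite mul1r.
rewrite lerXn2r ?nnegrE ?prod_ge0 ?(ltW (y0 _ Dx)) // -/(y x) yE.
apply: ler_prod => j _; rewrite ltW ?lam_gt0 //=; apply: lam_sorted => //.
by rewrite ffunE; apply: (incr_ge (f := h)); rewrite inE in inh.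
Qed.

Lemma iterative_eigenvalue (k : 'I_n) : iterative (fun x => lam x k).
Proof.
have le1 : (k <= n)%N by rewrite ltnW.
have [a Ha] := iterative_div (iterative_leading_product (ltn_ord k))
  (iterative_leading_product le1)
  (fun x Dx => lt0r_neq0 (prodr_gt0 _ (fun i _ => lam_gt0 Dx _))).
exists a => u uu; apply: computable_ext (Ha u uu) => x Dx.
rewrite big_ord_recr /=.
rewrite (eq_bigr (fun i => lam x (widen_ord le1 i))); last first.
  by move=> i _; congr (lam x _); apply: val_inj.
rewrite mulrAC divff ?mul1r; last by apply/lt0r_neq0/prodr_gt0 => i _; exact: lam_gt0.
by congr (lam x _); apply: val_inj.
Qed.

End Iterations.

(** * Algorithms with high relative accuracy *)

Section Specifications.
Variables (R : realType) (I : Type) (D : (I -> R) -> Prop).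

Lemma accurate_error u a b e p x v : unit_roundoff u -> (a <= b)%N ->
  accurate D u a e p -> D x -> computed u x e v ->
  `|v - p x| <= 2 ^+ b.+1 * u * `|p x|.
Proof.
move=> uu leab He Dx cv; have [_ /(_ v cv)[f Nf ->]] := He x Dx.
have /andP[u0 u1] := unit_roundoff01 uu; have /andP[_ u2] := uu.
have -> : p x * f - p x = (f - 1) * p x by rewrite mulrBl mul1r mulrC.
rewrite normrM ler_wpM2r //; apply: (near1_dist (u := u)); first by rewrite u0.
exact: near1_le Nf.
Qed.

Variable O : finType.

Lemma hra_direct_of (target : (I -> R) -> (O -> R) -> Prop) (y : (I -> R) -> O -> R) :
  (forall x, D x -> target x (y x)) -> (forall o, direct D (fun x => y x o)) ->
  hra_direct D target.
Proof.
move=> ty dy.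
have dy' o : exists ae : nat * expr I, sqrt_free ae.2 /\
    forall u, unit_roundoff u -> accurate D u ae.1 ae.2 (fun x => y x o).
  by have [a [e se He]] := dy o; exists (a, e).
have [ae Hae] := fin_all_exists dy'.
exists (fun o => (ae o).2) => [o|]; first exact: (Hae o).1.
exists (2 ^+ (\max_o (ae o).1).+1), 2^-1; split; first by rewrite invr_gt0.
move=> x Dx; exists (y x); first exact: ty.
move=> u uu o; have He := (Hae o).2 u uu; split; first exact: (He x Dx).1.
by move=> v cv; apply: (accurate_error uu _ He Dx cv); exact: leq_bigmax.
Qed.

Lemma hra_iterative_of (target : (I -> R) -> (O -> R) -> Prop) (y : (I -> R) -> O -> R) :
  (forall x, D x -> target x (y x)) -> (forall o, iterative D (fun x => y x o)) ->
  hra_iterative D target.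
Proof.
move=> ty iy; have [a Ha] := fin_all_exists iy.
have choice_e (uo : R * O) : exists e : expr I,
    unit_roundoff uo.1 -> accurate D uo.1 (a uo.2) e (fun x => y x uo.2).
  have [uu|nuu] := boolp.pselect (unit_roundoff uo.1); last by exists (EConst I 0).
  by have [e _ He] := Ha uo.2 uo.1 uu; exists e => _; exact: He.
have [alg Halg] := boolp.choice choice_e.
exists (fun u o => alg (u, o)).
exists (2 ^+ (\max_o a o).+1), 2^-1; split; first by rewrite invr_gt0.
move=> x Dx; exists (y x); first exact: ty.
move=> u uu o; have He := Halg (u, o) uu; split; first exact: (He x Dx).1.
by move=> v cv; apply: (accurate_error uu _ He Dx cv); exact: leq_bigmax.
Qed.

End Specifications.

Lemma direct_minors_stp (R : realType) (I : Type) (D : (I -> R) -> Prop) (n : nat)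
    (B : (I -> R) -> 'M[R]_n) x :
  direct_minors D B -> D x -> strictly_totally_positive (B x).
Proof. by move=> HB Dx k f g /incrP hf /incrP hg; apply: (HB k f g hf hg).1. Qed.

Lemma eigenvalues_iterative (R : realType) (I : Type) (D : (I -> R) -> Prop) (n : nat)
    (B : (I -> R) -> 'M[R]_n) :
  direct_minors D B -> exists lam : (I -> R) -> 'I_n -> R,
  (forall x, D x -> all_eigenvalues (B x) (lam x) /\ forall i, 0 < lam x i) /\
  forall i, iterative D (fun x => lam x i).
Proof.
move=> HB.
have choice_lam x : exists l : 'I_n -> R, D x ->
    [/\ all_eigenvalues (B x) l, forall i, 0 < l i &
      forall k N, \tr (compound k (B x) ^+ N) =
        \sum_(h in incrs k n) (\prod_j l (h j)) ^+ N].
  have [Dx|nDx] := boolp.pselect (D x); last by exists (fun=> 0).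
  by have [l Hl] := stp_eigenvalues (direct_minors_stp HB Dx); exists l.
have [lam Hlam] := boolp.choice choice_lam; exists lam; split=> [x /Hlam[]//|].
apply: (iterative_eigenvalue HB) => x /Hlam[] // [_ sorted_lam] _ _; exact: sorted_lam.
Qed.

(** Deleting a row and a column leaves an increasing selection, so that the
    cofactors are, up to sign, minors covered by the hypothesis. *)
Lemma signed_inverse (R : realType) (I : Type) (D : (I -> R) -> Prop) (n : nat)
    (B : (I -> R) -> 'M[R]_n) : direct_minors D B ->
  (forall x, D x -> B x \in unitmx) /\
  forall i j, exists c : (I -> R) -> R,
    [/\ forall x, D x -> 0 < c x, direct D c &
        forall x, D x -> invmx (B x) i j = (-1) ^+ (i + j) * c x].
Proof.
move=> HB; have incr_id : incr (@id 'I_n) by apply/incrP.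
have detE x : \det (mxsub id id (B x)) = \det (B x).
  by congr (\det _); apply/matrixP => i j; rewrite !mxE.
have [det_pos det_dir] := HB n id id incr_id incr_id.
have det_gt0 x : D x -> 0 < \det (B x) by rewrite -detE; exact: det_pos.
have unitB x : D x -> B x \in unitmx by move=> /det_gt0 d0; rewrite unitmxE unitfE gt_eqF.
split=> // i j; have incr_lift (l : 'I_n) : incr (lift l).
  by apply/incrP => a b ltab; rewrite /= /bump; lia.
have [min_pos min_dir] := HB _ _ _ (incr_lift j) (incr_lift i).
exists (fun x => \det (mxsub (lift j) (lift i) (B x)) / \det (mxsub id id (B x))); split.
- by move=> x Dx; rewrite divr_gt0 ?min_pos ?det_pos.
- by apply: direct_div => // x Dx; rewrite gt_eqF ?det_pos.
move=> x Dx; rewrite /invmx (unitB x Dx) !mxE detE /cofactor addnC mulrC mulrA.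
congr (_ * _ / _); congr (\det _); by apply/matrixP => a b; rewrite !mxE.
Qed.

(** Entries whose indices have the same parity have the same sign, the others
    opposite signs; this is also the sign pattern of the inverse. *)
Lemma alternating_signs_mul (R : realType) (n : nat) (b : 'I_n -> R) :
  alternating_signs b -> forall i j : 'I_n, 0 <= (-1) ^+ (i + j) * (b i * b j).
Proof.
move=> alt.
have up d (i j : 'I_n) : (j = i + d :> nat)%N -> 0 <= (-1) ^+ (i + j) * (b i * b j).
  elim: d j => [|d IH] j Ej.
    have -> : j = i by apply: val_inj; rewrite /= Ej addn0.
    by rewrite addnn -muln2 mulnC exprM sqrrN !expr1n mul1r -expr2 sqr_ge0.
  have ltl : (i + d < n)%N by apply: leq_ltn_trans (ltn_ord j); lia.
  pose l := Ordinal ltl.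
  have := IH l erefl; have := alt l j; rewrite /= Ej addnS => /(_ erefl) neg.
  have -> : (-1 : R) ^+ (i + (i + d).+1) = - (-1) ^+ (i + (i + d)).
    by rewrite addnS exprS mulN1r.
  have bl0 : b l != 0 by apply: contraTneq neg => ->; rewrite mul0r ltxx.
  have bl2 : 0 < b l ^+ 2 by rewrite exprn_even_gt0.
  move=> pos; rewrite -(pmulr_rge0 _ bl2).
  have -> : b l ^+ 2 * (- (-1) ^+ (i + (i + d)) * (b i * b j)) =
    - ((-1) ^+ (i + (i + d)) * (b i * b l) * (b l * b j)) by ring.
  by rewrite oppr_ge0 mulr_ge0_le0 // ltW.
move=> i j; case: (leqP i j) => leij; first by apply: (up (j - i)%N); lia.
by rewrite addnC [b i * _]mulrC; apply: (up (i - j)%N); lia.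
Qed.

Theorem theorem6 (R : realType) (n : nat) (hn : (0 < n)%N) :
  (forall t : 'I_n -> R,
     positive_increasing t -> strictly_totally_positive (bessel_mx t)) /\
  hra_iterative (@positive_increasing R n) (@eigenvalue_target R n) /\
  hra_iterative (@positive_increasing R n) (@singular_value_target R n) /\
  hra_direct (@positive_increasing R n) (@inverse_target R n) /\
  hra_direct (@system_data R n) (@system_target R n).
Proof.
pose D := @positive_increasing R n; pose D' := @system_data R n.
have minors : direct_minors D (@bessel_mx R n).
  exact: (@bessel_minors R 'I_n D n id (fun _ Dx => Dx)).
have minors' : direct_minors D' (fun x => bessel_mx (fun i => x (inl i))).
  exact: (@bessel_minors R _ D' n inl (fun _ Dx => Dx.1)).
split; first by move=> t Dt; exact: direct_minors_stp minors Dt.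
split.
  have [lam [Hlam it_lam]] := eigenvalues_iterative minors.
  by apply: (hra_iterative_of (y := lam)) => // x /Hlam[].
split.
  have [lam [Hlam it_lam]] := eigenvalues_iterative (gram_minors (leqnn n) minors).
  apply: (hra_iterative_of (y := fun x k => Num.sqrt (lam x k)))
    => [x /Hlam[[charp srt] pos]|k].
    split=> [k|]; first exact: sqrtr_ge0.
    split=> [|i j leij]; last by rewrite !sqr_sqrtr ?(ltW (pos _)) // srt.
    by rewrite charp; apply: eq_bigr => k _; rewrite sqr_sqrtr // ltW.
  by apply: iterative_sqrt => // x /Hlam[_ pos]; rewrite ltW.
split.
  have [unitM inv] := signed_inverse minors.
  apply: (hra_direct_of (y := fun t ij => invmx (bessel_mx t) ij.1 ij.2)) => [t Dt|[i j]].
    by split=> //; exact: unitM.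
  have [c [_ dc cE]] := inv i j.
  apply: (direct_ext (p := fun x => ((-1) ^+ (i + j))%:~R * c x)).
    by move=> t Dt; rewrite cE // rmorphXn rmorphN1.
  by apply: direct_mul => //; exact: direct_int.
have [unitM inv] := signed_inverse minors'.
pose y (x : 'I_n + 'I_n -> R) (i : 'I_n) : R :=
  (invmx (bessel_mx (fun i => x (inl i))) *m \col_j x (inr j)) i ord0.
apply: (@hra_direct_of R _ D' 'I_n _ y) => [x Dx|i].
  rewrite /system_target; have -> : \col_i y x i =
    invmx (bessel_mx (fun i => x (inl i))) *m \col_j x (inr j).
    by apply/colP => i; rewrite mxE.
  by rewrite mulKVmx // unitM.
have choice_c j : exists c : ('I_n + 'I_n -> R) -> R,
    [/\ forall x, D' x -> 0 < c x, direct D' c &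
        forall x, D' x -> invmx (bessel_mx (fun i => x (inl i))) i j =
          (-1) ^+ (i + j) * c x].
  exact: inv.
have [c Hc] := fin_all_exists choice_c.
apply: (direct_ext (p := fun x =>
    \sum_(j < n) ((-1) ^+ (i + j))%:~R * c j x * x (inr j))).
  move=> x Dx; rewrite /y mxE; apply: eq_bigr => j _; have [_ _ ->//] := Hc j.
  by rewrite mxE rmorphXn rmorphN1.
apply: direct_sum => [j _|x Dx j l _ _].
  apply: direct_mul; last exact: direct_data.
  by have [_ dc _] := Hc j; apply: direct_mul => //; exact: direct_int.
have [cj _ _] := Hc j; have [cl _ _] := Hc l.
have sgn := alternating_signs_mul Dx.2 j l.
rewrite !rmorphXn !rmorphN1.
have -> : (-1) ^+ (i + j) * c j x * x (inr j) * ((-1) ^+ (i + l) * c l x * x (inr l)) =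
  ((-1) ^+ (i + i) * (c j x * c l x)) * ((-1) ^+ (j + l) * (x (inr j) * x (inr l))).
  by rewrite !exprD; ring.
rewrite addnn -muln2 mulnC exprM sqrrN !expr1n mul1r.
by rewrite mulr_ge0 // mulr_ge0 // ltW ?cj ?cl.
Qed.
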